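(* Let $d=3$. Let $(z_r,\lambda_r)_{r=1}^{n_1}$, with $z_r=(z_r^1,z_r^2,z_r^3)\in\mathbb{R}^3$, be a degree 7 cubature formula for the 3-dimensional (standard) Gaussian measure. Let $(\eta_s,\mu_s)_{s=1}^{n_2}$, with $\eta_s=(\eta_s^0,\eta_s^1,\eta_s^2,\eta_s^3)\in\mathbb{R}^4$, be a degree 5 cubature formula for the four-dimensional Bernoulli measure. For letters $a_1,\dots,a_p\in\{0,1,2,3\}$ write $[a_1a_2\cdots a_p]:=[\cdots[[\varepsilon_{a_1},\varepsilon_{a_2}],\varepsilon_{a_3}],\cdots,\varepsilon_{a_p}]$ for the left-nested iterated Lie bracket. For $1\le r\le n_1$ and $1\le s\le n_2$ define \begin{align*} \ell_{r,s} &= \varepsilon_0+\sum_{i=1}^d z_r^i\varepsilon_i +\tfrac{1}{6}\eta_s^1\eta_s^2\big(z_r^1[122]+z_r^2[233]+z_r^3[311]\big)\\ &+\tfrac{1}{6}\eta_s^1\eta_s^3\big(z_r^1[133]+z_r^2[211]+z_r^3[322]\big)\\ &+\tfrac{1}{6}\eta_s^2\eta_s^3\big([123]+[231]+[312]\big) +\tfrac{1}{12}\sum_{i=1}^d[0ii]\\ &+\tfrac{1}{2\sqrt3}\big(\eta_s^1\eta_s^2\eta_s^0-\eta_s^2z_r^1+\eta_s^1z_r^2\big)[12] +\tfrac{1}{2\sqrt3}\big(\eta_s^1\eta_s^3\eta_s^0+\eta_s^3z_r^1+\eta_s^1z_r^3\big)[13]\\ &+\tfrac{1}{2\sqrt3}\big(\eta_s^2\eta_s^3\eta_s^0+\eta_s^3z_r^2+\eta_s^2z_r^3\big)[23]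 +\tfrac{1}{2\sqrt3}\big(\eta_s^3[03]-\eta_s^2[02]-\eta_s^1[01]\big)\\ &+\tfrac{1}{24\sqrt3}\,\eta_s^0\sum_{\substack{1\le i,j,k\le d\\ i<j\\ i\ne k\neq j}}\eta_s^i\eta_s^j\big([kjki]+[ijkk]+[ikkj]\big)\\ &+\tfrac{1}{12\sqrt3}\,\eta_s^0\sum_{\substack{1\le i,j,k\le d\\ i<j}}\eta_s^i\eta_s^j\big([ijjj]+[ijii]\big) +\tfrac{1}{12}\sum_{\substack{1\le i,j\le d\\ i\neq j}}[ijj]\\ &+\tfrac{1}{360}\sum_{i<j<k}\big(z_r^i[jkkji]+z_r^k[ijjki]+z_r^i[kijjk]+z_r^k[jiikj]+z_r^j[kjiik]+z_r^j[ikkij]\big)\\ &+\tfrac{1}{180}\sum_{i<j<k}\big(z_r^j[kiijk]+z_r^i[kjjik]+z_r^k[jkiij]+z_r^k[ikjji]\big)\\ &+\tfrac{1}{120}\sum_{i<j<k}\big(z_r^i[jikkj]+z_r^j[ijkki]\big) +\tfrac{1}{120}\sum_{\substack{1\le i,j,k\le d\\ i\ne j\ne k,\ i\neq k}}z_r^i[ikkjj]\\ &+\tfrac{1}{360}\sum_{\substack{1\le i,j\le d\\ i\ne j}}z_r^i[ijjjj] +\tfrac{1}{120}\sum_{\substack{1\le i,j\le d\\ i\ne j}}z_r^j[ijjji] +\tfrac{1}{90}\sum_{\substack{1\le i,j\le d\\ i\ne j}}z_r^i[ijiji]\\ &+\tfrac{1}{360}\sum_{i=1}^d[0iiii] +\tfrac{1}{120}\sum_{\substack{1\le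 i,j\le d\\ i\ne j}}[0iijj] +\tfrac{1}{180}\sum_{\substack{1\le i,j\le d\\ i\ne j}}[j0iij] +\tfrac{1}{360}\sum_{\substack{1\le i,j\le d\\ i\ne j}}[ijj0i], \end{align*} where the sums over $i<j<k$ run over $1\le i<j<k\le d$. Further define $\lambda_{r,s}=\lambda_r\mu_s$. Then $\{(\ell_{r,s},\lambda_{r,s}) : r\le n_1,\ s\le n_2\}$ defines a degree 7 cubature formula on Wiener space in $\mathbb{R}^3$.
   Context: **Cubature for a measure.** Points $x_1,\dots,x_n\in\mathbb{R}^D$ with weights $w_1,\dots,w_n\in\mathbb{R}$ define a degree $m$ cubature formula for a positive measure $\mu$ on $\mathbb{R}^D$ if $\int_{\mathbb{R}^D} P(x)\,\mu(dx)=\sum_{i=1}^n w_iP(x_i)$ for every real polynomial $P$ in $D$ variables of degree no more than $m$. The Bernoulli measure on $\mathbb{R}^D$ gives mass $2^{-D}$ to each point of $\{-1,1\}^D$. **Tensor algebra.** $\varepsilon_0,\varepsilon_1,\dots,\varepsilon_d$ is the canonical basis of $\mathbb{R}^{d+1}$, where index $0$ is the time coordinate. The tensor algebra over $\mathbb{R}^{d+1}$ is $\bigoplus_{k\ge 0}(\mathbb{R}^{d+1})^{\otimes k}$, with bracket $[a,b]=a\otimes b-b\otimes a$. Lie polynomials are finite linear combinations of iterated Lie brackets of basis elements; $\exp(a)=\sum_{k\ge0}\frac1{k!}a^{\otimes k}$, a formal series. $\pi_m$ is the projection that retains only tensors of order less than or equal to $m$, and $\mathcal{L}^{(m)}(\mathbb{R}^{d+1})$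 denotes the free Lie algebra over $\mathbb{R}^{d+1}$ truncated at level $m$. **Cubature on Wiener space.** Let $\widehat{B}$ be the time-augmented standard $d$-dimensional Brownian motion, $\widehat B_t=(t,B_t)$, and let $S^{(m)}_{[0,1]}(\circ \widehat B)$ be $\pi_m$ of its signature over $[0,1]$ (the collection of all iterated Stratonovich integrals). Lie polynomials $\ell_1,\dots,\ell_n\in\mathcal{L}^{(m)}(\mathbb{R}^{d+1})$ and associated positive weights $\lambda_1,\dots,\lambda_n\in\mathbb{R}$ define a degree $m$ cubature formula on Wiener space in $\mathbb{R}^d$ if $\mathbb{E}[S^{(m)}_{[0,1]}(\circ\widehat B)]=\sum_{k=1}^n\lambda_k\pi_m(\exp(\ell_k))$. Since the expected signature equals $\exp\big(\varepsilon_0+\frac12\sum_{i=1}^d\varepsilon_i^{\otimes2}\big)$, the condition reads $\pi_m\big(\exp(\varepsilon_0+\frac12\sum_{i=1}^d\varepsilon_i^{\otimes2})\big)=\sum_{k=1}^n\lambda_k\pi_m(\exp(\ell_k))$.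
   Formalization: Corrected: 1/12 sum of [ijj] gets factor z_r^i; the eta^2 eta^3 line reads z^1[123]+z^2[231]+z^3[312]; the [ijjj]+[ijii] sum is over i<j only (no k); tensor order counts letter 0 twice; weights lambda_r, mu_s are assumed positive. *)

(* Defs.v *)
From HB Require Import structures.
From mathcomp Require Import all_boot all_order all_algebra.
From mathcomp Require Import all_classical all_reals all_analysis.
(* The notations of mpoly clash with those of MathComp-Analysis. *)
From mathcomp Require Import (canonicals, coercions) mpoly.

Set Implicit Arguments.
Unset Strict Implicit.
Unset Printing Implicit Defensive.

Import Order.TTheory GRing.Theory Num.Theory.
Local Open Scope classical_set_scope.
Local Open Scope ring_scope.

(* Degree m cubature for a measure on R^D.  mpoly.msize is 1 + total degree
   (0 for the zero polynomial). An integral equal to a finite value is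
   necessarily convergent. *)
Definition cubature (R : realType) (D m : nat)
    (mu : {measure set (D.-tuple R) -> \bar R})
    (n : nat) (x : 'I_n -> D.-tuple R) (w : 'I_n -> R) : Prop :=
  forall P : mpoly.mpoly D R, (mpoly.msize P <= m.+1)%N ->
    (\int[mu]_t (mpoly.meval (tnth t) P)%:E)%E
    = (\sum_(i < n) w i * mpoly.meval (tnth (x i)) P)%:E.

(* normal_prob is a measure on measurableTypeR R, whose carrier and measurable
   sets are those of R. *)
Definition cons_pair (R : realType) (D : nat)
    (p : measurableTypeR R * D.-tuple R) : D.+1.-tuple R :=
  [tuple of (p.1 : R) :: p.2].

Lemma measurable_cons_pair (R : realType) (D : nat) :
  measurable_fun [set: measurableTypeR R * D.-tuple R] (@cons_pair R D).
Proof.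
apply: (measurable_cons (f := fun p : measurableTypeR R * D.-tuple R => p.1 : R)
                        (g := fun p => p.2)).
  exact: (@measurable_fst _ _ (measurableTypeR R) (D.-tuple R)).
exact: measurable_snd.
Qed.

HB.instance Definition _ (R : realType) (D : nat) :=
  isMeasurableFun.Build _ _ _ _ (@cons_pair R D) (@measurable_cons_pair R D).

Fixpoint std_gaussian (R : realType) (D : nat) : probability (D.-tuple R) R :=
  if D is D'.+1 then
    distribution (normal_prob (0 : R) 1 \x std_gaussian R D')%E (@cons_pair R D')
  else \d_([tuple] : 0.-tuple R).

Definition sign_point (R : realType) (D : nat) (b : D.-tuple bool) :
  D.-tuple R := [tuple (-1) ^+ tnth b i | i < D].

(* k ranges over the 2 ^ D elements of the enumeration of D.-tuple bool. *)
Definition bernoulli_measure (R : realType) (D : nat) :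
    {measure set (D.-tuple R) -> \bar R} :=
  mscale ((2 ^- D)%:nng : {nonneg R})
    (msum (fun k : nat =>
             \d_(@sign_point R D (nth [tuple of nseq D false]
                                      (enum {: D.-tuple bool}) k)))
          (2 ^ D)%N).

(* Formal tensor series over R^{d+1}: the value at a word a_1 ... a_p is the
   coefficient of eps_{a_1} (x) ... (x) eps_{a_p}.  Addition and scaling are the
   pointwise ones; R^o makes R act on the values. *)
Definition tseries (R : realType) (d : nat) := seq 'I_d.+1 -> R^o.

HB.instance Definition _ (R : realType) (d : nat) :=
  GRing.Lmodule.on (tseries R d).

Section TensorSeries.
Context {R : realType} {d : nat}.
Implicit Types (a b : tseries R d) (w : seq 'I_d.+1) (m k : nat).

Definition tone : tseries R d := fun w => (w == [::])%:R.

Definition eps (c : 'I_d.+1) : tseries R d := fun w => (w == [:: c])%:R.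

Definition tmul a b : tseries R d :=
  fun w => \sum_(i < (size w).+1) a (take i w) * b (drop i w).

Definition tpow a k : tseries R d := iter k (tmul a) tone.

(* Meant for series without constant term: then a^k vanishes on words of length
   less than k (tpow_short), so the sum is the full exponential series. *)
Definition texp a : tseries R d :=
  fun w => \sum_(k < (size w).+1) (k`!%:R)^-1 * tpow a k w.

Lemma tpow_short a k w : a [::] = 0 -> (size w < k)%N -> tpow a k w = 0.
Proof.
move=> a0; elim: k w => [//|k IHk] w sw; rewrite /tpow iterS /tmul.
apply: big1 => -[[|i] /= ltiw] _; first by rewrite take0 a0 mul0r.
rewrite -/(tpow a k) IHk ?mulr0// size_drop.
move: sw ltiw; rewrite !ltnS => sw ltiw.
by apply: leq_trans sw; rewrite ltn_subrL /= (leq_trans _ ltiw).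
Qed.

Definition tbracket a b : tseries R d := tmul a b - tmul b a.

(* [c l_1 ... l_p], nested to the left. *)
Definition left_bracket (c : 'I_d.+1) (l : seq 'I_d.+1) : tseries R d :=
  foldl (fun a e => tbracket a (eps e)) (eps c) l.

(* The order of a word, for which the time letter 0 counts twice (Brownian
   scaling). *)
Definition word_order w : nat := \sum_(c <- w) (if c == ord0 then 2 else 1)%N.

Definition tproj m a : tseries R d :=
  fun w => if (word_order w <= m)%N then a w else 0.

Inductive iterated_bracket : tseries R d -> Prop :=
| iterated_bracket_eps c : iterated_bracket (eps c)
| iterated_bracket_bracket a b :
    iterated_bracket a -> iterated_bracket b -> iterated_bracket (tbracket a b).

Definition lie_polynomial a : Prop :=
  exists (n : nat) (c : 'I_n -> R) (b : 'I_n -> tseries R d),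
    (forall i, iterated_bracket (b i)) /\ a = \sum_(i < n) c i *: b i.

Definition lie_truncated m a : Prop :=
  exists2 b, lie_polynomial b & a = tproj m b.

(* exp(eps_0 + 1/2 sum_i eps_i (x) eps_i) is the expected Stratonovich signature
   over [0, 1] of time-augmented d-dimensional Brownian motion. *)
Definition expected_signature : tseries R d :=
  texp (eps ord0
        + 2^-1 *: \sum_(i < d) tmul (eps (lift ord0 i)) (eps (lift ord0 i))).

Definition wiener_cubature m (I : finType) (l : I -> tseries R d) (w : I -> R) :
  Prop :=
  [/\ forall k : I, 0 < w k,
      forall k : I, lie_truncated m (l k)
    & tproj m expected_signature = \sum_(k : I) w k *: tproj m (texp (l k))].

End TensorSeries.

(* The spatial indices 1, 2, 3 are i1, i2, i3 : 'I_3; the spatial index i has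
   letter lift ord0 i : 'I_4, and ord0 : 'I_4 is the time letter.  The
   coordinates of eta are indexed by letters. *)
Definition wiener_lie3 (R : realType) (z : 3.-tuple R) (eta : 4.-tuple R) :
    tseries R 3 :=
  let i1 : 'I_3 := @Ordinal 3 0 isT in
  let i2 : 'I_3 := @Ordinal 3 1 isT in
  let i3 : 'I_3 := @Ordinal 3 2 isT in
  let Z i := tnth z i in
  let h0 := tnth eta ord0 in
  let h i := tnth eta (lift ord0 i) in
  let x i : 'I_4 := lift ord0 i in
  let t : 'I_4 := ord0 in
  let br (i : 'I_3) (l : seq 'I_3) := left_bracket (x i) (map x l) in
  let br0 (l : seq 'I_3) := left_bracket t (map x l) in
  let s3 : R := Num.sqrt 3 in
  eps t + \sum_(i < 3) Z i *: eps (x i)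
  + (1 / 6 * h i1 * h i2) *:
      (Z i1 *: br i1 [:: i2; i2] + Z i2 *: br i2 [:: i3; i3]
       + Z i3 *: br i3 [:: i1; i1])
  + (1 / 6 * h i1 * h i3) *:
      (Z i1 *: br i1 [:: i3; i3] + Z i2 *: br i2 [:: i1; i1]
       + Z i3 *: br i3 [:: i2; i2])
  (* The factors Z are essential: without them the bracket sum is 0 by the
     Jacobi identity. *)
  + (1 / 6 * h i2 * h i3) *:
      (Z i1 *: br i1 [:: i2; i3] + Z i2 *: br i2 [:: i3; i1]
       + Z i3 *: br i3 [:: i1; i2])
  + (1 / 12) *: \sum_(i < 3) br0 [:: i; i]
  + (1 / (2 * s3) * (h i1 * h i2 * h0 - h i2 * Z i1 + h i1 * Z i2)) *:
      br i1 [:: i2]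
  + (1 / (2 * s3) * (h i1 * h i3 * h0 + h i3 * Z i1 + h i1 * Z i3)) *:
      br i1 [:: i3]
  + (1 / (2 * s3) * (h i2 * h i3 * h0 + h i3 * Z i2 + h i2 * Z i3)) *:
      br i2 [:: i3]
  + (1 / (2 * s3)) *: (h i3 *: br0 [:: i3] - h i2 *: br0 [:: i2]
                       - h i1 *: br0 [:: i1])
  + (1 / (24 * s3) * h0) *:
      \sum_(i < 3) \sum_(j < 3 | (i < j)%N)
        \sum_(k < 3 | (i != k) && (k != j))
          (h i * h j) *:
            (br k [:: j; k; i] + br i [:: j; k; k] + br i [:: k; k; j])
  (* A sum over the pairs i < j only: the summand does not involve a third
     index. *)
  + (1 / (12 * s3) * h0) *:
      \sum_(i < 3) \sum_(j < 3 | (i < j)%N)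
        (h i * h j) *: (br i [:: j; j; j] + br i [:: j; i; i])
  (* The factor Z i is essential: without it the word i j j, of odd order, would
     get the nonzero mean 1/12. *)
  + (1 / 12) *: \sum_(i < 3) \sum_(j < 3 | i != j) Z i *: br i [:: j; j]
  + (1 / 360) *:
      \sum_(i < 3) \sum_(j < 3 | (i < j)%N) \sum_(k < 3 | (j < k)%N)
        (Z i *: br j [:: k; k; j; i] + Z k *: br i [:: j; j; k; i]
         + Z i *: br k [:: i; j; j; k] + Z k *: br j [:: i; i; k; j]
         + Z j *: br k [:: j; i; i; k] + Z j *: br i [:: k; k; i; j])
  + (1 / 180) *:
      \sum_(i < 3) \sum_(j < 3 | (i < j)%N) \sum_(k < 3 | (j < k)%N)
        (Z j *: br k [:: i; i; j; k] + Z i *: br k [:: j; j; i; k]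
         + Z k *: br j [:: k; i; i; j] + Z k *: br i [:: k; j; j; i])
  + (1 / 120) *:
      \sum_(i < 3) \sum_(j < 3 | (i < j)%N) \sum_(k < 3 | (j < k)%N)
        (Z i *: br j [:: i; k; k; j] + Z j *: br i [:: j; k; k; i])
  + (1 / 120) *:
      \sum_(i < 3) \sum_(j < 3) \sum_(k < 3 | [&& i != j, j != k & i != k])
        Z i *: br i [:: k; k; j; j]
  + (1 / 360) *: \sum_(i < 3) \sum_(j < 3 | i != j) Z i *: br i [:: j; j; j; j]
  + (1 / 120) *: \sum_(i < 3) \sum_(j < 3 | i != j) Z j *: br i [:: j; j; j; i]
  + (1 / 90) *: \sum_(i < 3) \sum_(j < 3 | i != j) Z i *: br i [:: j; i; j; i]
  + (1 / 360) *: \sum_(i < 3) br0 [:: i; i; i; i]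
  + (1 / 120) *: \sum_(i < 3) \sum_(j < 3 | i != j) br0 [:: i; i; j; j]
  + (1 / 180) *:
      \sum_(i < 3) \sum_(j < 3 | i != j) left_bracket (x j) [:: t; x i; x i; x j]
  + (1 / 360) *:
      \sum_(i < 3) \sum_(j < 3 | i != j)
        left_bracket (x i) [:: x j; x j; t; x i].

(* Main.v *)
From Stdlib Require Import BinInt.
Require Import Defs.
From mathcomp Require Import all_boot all_order all_algebra.
From mathcomp Require Import all_classical all_reals all_analysis.
From mathcomp Require Import measurable_realfun ssrZ ring lra.
From mathcomp Require mpoly.

Set Implicit Arguments.
Unset Strict Implicit.
Unset Printing Implicit Defensive.

Import Order.TTheory GRing.Theory Num.Theory.
Local Open Scope ring_scope.
Local Arguments Z.mul : simpl never.
Local Arguments Z.add : simpl never.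

(* A cubature formula for the Bernoulli measure of degree at least 4 and with positive
   weights has all its nodes on the cube, because [(x ^ 2 - 1) ^ 2] has mean 0 there.
   Hence [theta := sqrt 3 * eta] satisfies [theta_i ^ 2 = 3], and [1080 *: l_{r,s}] has
   integer coefficients in the variables [z] and [theta].  In the exponential, the
   coefficient of a word of order [n] is a polynomial of degree at most [n] in [z] whose
   degree in [z, theta_1, theta_2, theta_3] together has the parity of [n].  For odd [n]
   its mean vanishes by symmetry, so the words of order 7 need no computation; for the
   words of order at most 6 both sides are evaluated on tries of integer polynomials,
   with the moments of the Gaussian and of the Bernoulli measure. *)

(** * Integer polynomials and tries *)

(** The two exponentials do not agree node by node, only in the mean. Polynomials in [z] and [theta]
    therefore have to be carried through the whole exponential, and means are taken last. With
    denominators cleared, these means are integers, so their vanishing can be decided by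
    computation. The constant 1080 is the least common multiple of 360 and 216. The denominators of
    the coefficients without [eta] divide 360, while [eta_0 eta_i eta_j / (24 sqrt 3)] equals
    [theta_0 theta_i theta_j / 216]; the other coefficients with [eta] become multiples of 1/108,
    1/18 or 1/6. The exponential contains high powers of [eta], but a Bernoulli formula of degree 5
    suffices: after reduction by [theta_i ^ 2 = 3] every monomial is squarefree in four variables,
    hence of degree at most 4. The coordinate [theta_0] stays out of the parity count because it
    occurs only in products [theta_0 theta_i theta_j] in front of brackets of order 2 or 4; counting
    it would break the parity. *)

Fixpoint exponent_add (a b : seq nat) : seq nat :=
  match a, b with
  | i :: a', j :: b' => (i + j)%N :: exponent_add a' b'
  | [::], _ => b
  | _, [::] => a
  end.

Fixpoint sign_add (a b : seq bool) : seq bool :=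
  match a, b with
  | i :: a', j :: b' => (i (+) j) :: sign_add a' b'
  | [::], _ => b
  | _, [::] => a
  end.

(* The factor produced by [theta_i ^ 2 = 3]. *)
Fixpoint sign_carry (a b : seq bool) : Z :=
  match a, b with
  | i :: a', j :: b' =>
      if i && j then Z.mul 3 (sign_carry a' b') else sign_carry a' b'
  | _, _ => Zpos xH
  end.

(* Exponents of the [theta_i] modulo 2 and of the [z_i]; missing entries are 0. *)
Definition monomial := (seq bool * seq nat)%type.

Definition monomial_mul (m n : monomial) : monomial :=
  (sign_add m.1 n.1, exponent_add m.2 n.2).

Definition zpoly := seq (Z * monomial).

Definition zpoly_const (c : Z) : zpoly := [:: (c, ([::], [::]))].

Definition zpoly_nat (n : nat) : zpoly := zpoly_const (Z.of_nat n).

Definition zpoly_z (i : nat) : zpoly := [:: (Zpos xH, ([::], rcons (nseq i 0%N) 1%N))].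

Definition zpoly_theta (i : nat) : zpoly :=
  [:: (Zpos xH, (rcons (nseq i false) true, [::]))].

(* The lazy [if] avoids both the cost of [eq_op] on a product of sequences and the
   strict evaluation of the second conjunct. *)
Fixpoint list_eqb (T : Type) (e : T -> T -> bool) (a b : seq T) : bool :=
  match a, b with
  | x :: a', y :: b' => if e x y then list_eqb e a' b' else false
  | [::], [::] => true
  | _, _ => false
  end.

Definition monomial_eqb (m n : monomial) : bool :=
  if list_eqb Bool.eqb m.1 n.1 then list_eqb Nat.eqb m.2 n.2 else false.

(** Merging equal monomials and dropping zero coefficients keeps the computation small; evaluation
    is correct for any list of terms, normalized or not. *)
Fixpoint zpoly_insert (c : Z) (m : monomial) (p : zpoly) : zpoly :=
  if p is (c', m') :: p' then
    if monomial_eqb m m' then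
      let s := Z.add c c' in if Z.eqb s 0 then p' else (s, m) :: p'
    else (c', m') :: zpoly_insert c m p'
  else [:: (c, m)].

Definition zpoly_add (p q : zpoly) : zpoly :=
  foldr (fun t => zpoly_insert t.1 t.2) q p.

Definition zpoly_mul_term (c : Z) (m : monomial) (p : zpoly) : zpoly :=
  [seq (Z.mul (Z.mul c (sign_carry m.1 t.2.1)) t.1, monomial_mul m t.2) | t <- p].

Definition zpoly_mul (p q : zpoly) : zpoly :=
  foldr (fun t => zpoly_add (zpoly_mul_term t.1 t.2 q)) [::] p.

Definition zpoly_opp (p : zpoly) : zpoly := zpoly_mul (zpoly_const (Zneg xH)) p.

(* The coefficient of the empty word and, for each first letter, the series of the
   remaining words. *)
Inductive trie := Leaf | Node (p : zpoly) (t0 t1 t2 t3 : trie).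

Definition trie_root (t : trie) : zpoly := if t is Node p _ _ _ _ then p else [::].

Fixpoint trie_add (a b : trie) : trie :=
  match a, b with
  | Leaf, _ => b
  | _, Leaf => a
  | Node p a0 a1 a2 a3, Node q b0 b1 b2 b3 =>
      Node (zpoly_add p q)
        (trie_add a0 b0) (trie_add a1 b1) (trie_add a2 b2) (trie_add a3 b3)
  end.

(* [m] bounds the order of the words that are kept; the letter 0 uses up 2. *)
Fixpoint trie_scale (m : nat) (p : zpoly) (b : trie) {struct b} : trie :=
  if b is Node q b0 b1 b2 b3 then
    Node (zpoly_mul p q)
      (if m is m'.+2 then trie_scale m' p b0 else Leaf)
      (if m is m'.+1 then trie_scale m' p b1 else Leaf)
      (if m is m'.+1 then trie_scale m' p b2 else Leaf)
      (if m is m'.+1 then trie_scale m' p b3 else Leaf)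
  else Leaf.

(** A child of [a] is its left quotient by a letter, so the product follows the recursion
    [tmul_cons]. The test on [p] skips the common case of a vanishing constant term. *)
Fixpoint trie_mul (m : nat) (a b : trie) {struct a} : trie :=
  if a is Node p a0 a1 a2 a3 then
    let r := Node [::]
      (if m is m'.+2 then trie_mul m' a0 b else Leaf)
      (if m is m'.+1 then trie_mul m' a1 b else Leaf)
      (if m is m'.+1 then trie_mul m' a2 b else Leaf)
      (if m is m'.+1 then trie_mul m' a3 b else Leaf) in
    if p is [::] then r else trie_add (trie_scale m p b) r
  else Leaf.

Definition trie_const (c : Z) : trie := Node (zpoly_const c) Leaf Leaf Leaf Leaf.

Definition trie_eps (c : nat) : trie :=
  let one := trie_const (Zpos xH) in
  match c with
  | 0 => Node [::] one Leaf Leaf Leaf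
  | 1 => Node [::] Leaf one Leaf Leaf
  | 2 => Node [::] Leaf Leaf one Leaf
  | _ => Node [::] Leaf Leaf Leaf one
  end.

Definition trie_bracket (m : nat) (a b : trie) : trie :=
  trie_add (trie_mul m a b)
           (trie_scale m (zpoly_opp (zpoly_nat 1)) (trie_mul m b a)).

Definition trie_left_bracket (m : nat) (c : nat) (l : seq nat) : trie :=
  foldl (fun a e => trie_bracket m a (trie_eps e)) (trie_eps c) l.

(** [pw] is the current power of [a], and [cs] lists the integer coefficients of this power and the
    following ones. *)
Fixpoint trie_series (m : nat) (a pw : trie) (cs : seq Z) : trie :=
  if cs is c :: cs' then
    trie_add (trie_scale m (zpoly_const c) pw)
             (trie_series m a (trie_mul m a pw) cs')
  else Leaf.

Lemma list_eqb_eq (T : Type) (e : T -> T -> bool) a b :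
  (forall x y, e x y -> x = y) -> list_eqb e a b -> a = b.
Proof.
move=> eP; elim: a b => [|x a IH] [|y b] //=.
by case: ifP => // /eP -> /IH ->.
Qed.

Lemma monomial_eqb_eq m n : monomial_eqb m n -> m = n.
Proof.
case: m n => [s e] [s' e']; rewrite /monomial_eqb /=; case: ifP => // eqs eqe.
rewrite (list_eqb_eq _ eqs) ?(list_eqb_eq _ eqe)//.
  by move=> x y /eqnP.
by move=> [] [].
Qed.

(** * Real values of integer polynomials and tries *)

Section Evaluation.
Variable R : realType.
Implicit Types (x th zs : nat -> R) (s t : trie) (p q : zpoly).

Definition zr (c : Z) : R := (int_of_Z c)%:~R.

Lemma zr0 : zr Z0 = 0. Proof. by []. Qed.
Lemma zr1 : zr (Zpos xH) = 1. Proof. by []. Qed.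
Lemma zrD a b : zr (Z.add a b) = zr a + zr b.
Proof. by rewrite /zr (rmorphD int_of_Z) rmorphD. Qed.
Lemma zrM a b : zr (Z.mul a b) = zr a * zr b.
Proof. by rewrite /zr (rmorphM int_of_Z) rmorphM. Qed.
Lemma zr_nat n : zr (Z.of_nat n) = n%:R.
Proof. by rewrite /zr -{1}[n]natn 3!rmorph_nat. Qed.

Fixpoint exponent_eval x (e : seq nat) : R :=
  if e is k :: e' then x 0%N ^+ k * exponent_eval (fun i => x i.+1) e' else 1.

Lemma exponent_evalD x a b :
  exponent_eval x (exponent_add a b) = exponent_eval x a * exponent_eval x b.
Proof.
elim: a b x => [|i a IH] [|j b] x /=; rewrite ?mul1r ?mulr1 //.
by rewrite IH exprD mulrACA.
Qed.

Definition sign_eval x (e : seq bool) : R := exponent_eval x (map nat_of_bool e).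

Lemma sign_evalD x a b : (forall i, x i ^+ 2 = 3) ->
  zr (sign_carry a b) * sign_eval x (sign_add a b) = sign_eval x a * sign_eval x b.
Proof.
rewrite /sign_eval; elim: a b x => [|i a IH] [|j b] x x3 /=; rewrite ?zr1 ?mul1r ?mulr1 //.
have {}IH := IH b (fun k => x k.+1) (fun k => x3 k.+1).
rewrite mulrACA -IH.
case: i; case: j => /=; rewrite ?expr0 ?expr1 ?mul1r ?mulr1 -?expr2 ?x3 ?zrM//.
- by rewrite !mulrA.
- by rewrite mulrCA.
- by rewrite mulrCA.
Qed.

Definition monomial_eval th zs (m : monomial) : R :=
  sign_eval th m.1 * exponent_eval zs m.2.

Lemma monomial_evalM th zs m n : (forall i, th i ^+ 2 = 3) ->
  zr (sign_carry m.1 n.1) * monomial_eval th zs (monomial_mul m n)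
  = monomial_eval th zs m * monomial_eval th zs n.
Proof.
by move=> th3; rewrite /monomial_eval mulrA sign_evalD// exponent_evalD mulrACA.
Qed.

Definition zpoly_eval th zs p : R := \sum_(t <- p) zr t.1 * monomial_eval th zs t.2.

Section Environment.
Variables th zs : nat -> R.
Hypothesis th3 : forall i, th i ^+ 2 = 3.
Notation pev := (zpoly_eval th zs).
Notation mev := (monomial_eval th zs).

Lemma zpoly_eval_nil : pev [::] = 0. Proof. exact: big_nil. Qed.

Lemma zpoly_eval_cons c m p : pev ((c, m) :: p) = zr c * mev m + pev p.
Proof. exact: big_cons. Qed.

Lemma zpoly_eval_const c : pev (zpoly_const c) = zr c.
Proof.
by rewrite zpoly_eval_cons zpoly_eval_nil addr0 /monomial_eval /sign_eval /= !mulr1.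
Qed.

Lemma zpoly_eval_nat n : pev (zpoly_nat n) = n%:R.
Proof. by rewrite zpoly_eval_const zr_nat. Qed.

Lemma exponent_eval_delta x i : exponent_eval x (rcons (nseq i 0%N) 1%N) = x i.
Proof. by elim: i x => [|i IH] x /=; rewrite ?mulr1 ?mul1r ?IH. Qed.

Lemma zpoly_eval_z i : pev (zpoly_z i) = zs i.
Proof.
by rewrite zpoly_eval_cons zpoly_eval_nil addr0 /monomial_eval exponent_eval_delta !mul1r.
Qed.

Lemma zpoly_eval_theta i : pev (zpoly_theta i) = th i.
Proof.
rewrite zpoly_eval_cons zpoly_eval_nil addr0 /monomial_eval /sign_eval map_rcons map_nseq.
by rewrite exponent_eval_delta mul1r mulr1.
Qed.

Lemma zpoly_eval_insert c m p : pev (zpoly_insert c m p) = zr c * mev m + pev p.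
Proof.
elim: p => [|[c' m'] p IH] /=; first by rewrite zpoly_eval_cons.
case: ifP => [/monomial_eqb_eq <-|_]; last by rewrite !zpoly_eval_cons IH addrCA.
rewrite [in RHS]zpoly_eval_cons addrA -mulrDl -zrD.
case: Z.eqb_spec => [->|_]; last by rewrite zpoly_eval_cons.
by rewrite zr0 mul0r add0r.
Qed.

Lemma zpoly_eval_add p q : pev (zpoly_add p q) = pev p + pev q.
Proof.
elim: p => [|[c m] p IH] /=; first by rewrite zpoly_eval_nil add0r.
by rewrite zpoly_eval_insert IH zpoly_eval_cons addrA.
Qed.

Lemma zpoly_eval_mul_term c m p : pev (zpoly_mul_term c m p) = zr c * mev m * pev p.
Proof.
elim: p => [|[c' n] p IH] /=; first by rewrite !zpoly_eval_nil mulr0.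
rewrite !zpoly_eval_cons IH mulrDr; congr (_ + _).
by rewrite !zrM [RHS]mulrACA -monomial_evalM //; ring.
Qed.

Lemma zpoly_eval_mul p q : pev (zpoly_mul p q) = pev p * pev q.
Proof.
elim: p => [|[c m] p IH] /=; first by rewrite !zpoly_eval_nil mul0r.
by rewrite zpoly_eval_add IH zpoly_eval_mul_term zpoly_eval_cons mulrDl.
Qed.


Lemma zpoly_eval_opp p : pev (zpoly_opp p) = - pev p.
Proof. by rewrite zpoly_eval_mul zpoly_eval_const mulN1r. Qed.

Fixpoint trie_eval t (w : seq 'I_4) : R :=
  if t is Node p t0 t1 t2 t3 then
    if w is c :: w' then
      match val c with
      | 0 => trie_eval t0 w' | 1 => trie_eval t1 w'
      | 2 => trie_eval t2 w' | _ => trie_eval t3 w'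
      end
    else pev p
  else 0.
Notation tev := (trie_eval : trie -> tseries R 3).

Lemma trie_eval_leaf w : tev Leaf w = 0. Proof. by case: w. Qed.

(** Letters in the [lift ord0] form, on which both [val] and the comparison with [ord0] compute. *)
Lemma letterP (P : 'I_4 -> Prop) :
  P ord0 -> P (lift ord0 ord0) -> P (lift ord0 (lift ord0 ord0)) ->
  P (lift ord0 (lift ord0 (lift ord0 ord0))) -> forall c, P c.
Proof.
move=> P0 P1 P2 P3 [[|[|[|[|//]]]] ltc].
- by rewrite (_ : Ordinal ltc = ord0)//; apply: val_inj.
- by rewrite (_ : Ordinal ltc = lift ord0 ord0)//; apply: val_inj.
- by rewrite (_ : Ordinal ltc = lift ord0 (lift ord0 ord0))//; apply: val_inj.
- by rewrite (_ : Ordinal ltc = lift ord0 (lift ord0 (lift ord0 ord0)))//; apply: val_inj.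
Qed.

Lemma word_order_cons d (c : 'I_d.+1) w :
  word_order (c :: w) = ((if c == ord0 then 2 else 1) + word_order w)%N.
Proof. exact: big_cons. Qed.

Lemma trie_eval_add s t w : tev (trie_add s t) w = tev s w + tev t w.
Proof.
elim: s t w => [|p s0 IH0 s1 IH1 s2 IH2 s3 IH3] [|q t0 t1 t2 t3] w;
  rewrite ?trie_eval_leaf ?add0r ?addr0//=.
case: w => [|c w]; first exact: zpoly_eval_add.
by elim/letterP: c => /=.
Qed.

Lemma trie_eval_scale m p t w : (word_order w <= m)%N ->
  tev (trie_scale m p t) w = pev p * tev t w.
Proof.
elim: t m w => [|q t0 IH0 t1 IH1 t2 IH2 t3 IH3] m w; first by rewrite /= mulr0.
case: w => [|c w] /= ordw; first exact: zpoly_eval_mul.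
elim/letterP: c ordw; rewrite word_order_cons /=.
- by case: m => [|[|m]]//; rewrite !addSn !ltnS; apply: IH0.
- by case: m => [|m]//; rewrite addSn ltnS; apply: IH1.
- by case: m => [|m]//; rewrite addSn ltnS; apply: IH2.
- by case: m => [|m]//; rewrite addSn ltnS; apply: IH3.
Qed.

Lemma tmul_nil d (a b : tseries R d) : tmul a b [::] = a [::] * b [::].
Proof. by rewrite /tmul big_ord_recl big_ord0 addr0. Qed.

Lemma tmul_cons d (a b : tseries R d) c w :
  tmul a b (c :: w) = a [::] * b (c :: w) + tmul (fun u => a (c :: u)) b w.
Proof. by rewrite /tmul big_ord_recl. Qed.

Lemma tmul0l d (b : tseries R d) w : tmul (fun=> 0) b w = 0.
Proof. by apply: big1 => i _; rewrite mul0r. Qed.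

Lemma trie_eval_mul m s t w : (word_order w <= m)%N ->
  tev (trie_mul m s t) w = tmul (tev s) (tev t) w.
Proof.
elim: s m w => [|p s0 IH0 s1 IH1 s2 IH2 s3 IH3] m w ordw.
  rewrite trie_eval_leaf -(tmul0l (tev t) w); apply: eq_bigr => i _.
  by rewrite trie_eval_leaf.
set r := Node [::] (if m is m'.+2 then trie_mul m' s0 t else Leaf)
      (if m is m'.+1 then trie_mul m' s1 t else Leaf)
      (if m is m'.+1 then trie_mul m' s2 t else Leaf)
      (if m is m'.+1 then trie_mul m' s3 t else Leaf).
(* This covers both branches of the test on [p], since the empty polynomial evaluates to 0. *)
have -> : tev (trie_mul m (Node p s0 s1 s2 s3) t) w = pev p * tev t w + tev r w.
  rewrite [trie_mul _ _ _]/= -/r; case: p => [|x p].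
    by rewrite zpoly_eval_nil mul0r add0r.
  by rewrite trie_eval_add trie_eval_scale.
case: w ordw => [|c w] ordw; first by rewrite tmul_nil /= zpoly_eval_nil addr0.
rewrite tmul_cons; congr (_ + _).
elim/letterP: c ordw; rewrite word_order_cons /r /=.
- by case: m {r} => [|[|m]]//; rewrite !addSn !ltnS => /IH0.
- by case: m {r} => [|m]//; rewrite addSn ltnS => /IH1.
- by case: m {r} => [|m]//; rewrite addSn ltnS => /IH2.
- by case: m {r} => [|m]//; rewrite addSn ltnS => /IH3.
Qed.

Lemma trie_eval_const c w : tev (trie_const c) w = zr c * tone w.
Proof.
case: w => [|e w]; first by rewrite /= zpoly_eval_const /tone eqxx mulr1.
by elim/letterP: e; rewrite /tone /= ?trie_eval_leaf mulr0.
Qed.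

Lemma trie_eval_eps (c : 'I_4) : tev (trie_eps c) = eps c.
Proof.
apply/funext => w; elim/letterP: c; case: w => [|e w] /=; rewrite ?zpoly_eval_nil//;
elim/letterP: e; rewrite ?trie_eval_leaf//;
by case: w => [|e w] /=; rewrite ?zpoly_eval_const//; elim/letterP: e.
Qed.

End Environment.
End Evaluation.

(** * Truncated products and exponentials *)

Section Series.
Variables (R : realType) (d : nat).
Implicit Types (a b : tseries R d) (w : seq 'I_d.+1).

Lemma word_order_cat w w' : word_order (w ++ w') = (word_order w + word_order w')%N.
Proof. exact: big_cat. Qed.

Lemma size_le_word_order w : (size w <= word_order w)%N.
Proof.
elim: w => [//|c w IH]; rewrite word_order_cons /= -add1n leq_add//.
by case: ifP.
Qed.

Definition agree m a b := forall w, (word_order w <= m)%N -> a w = b w.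

(** Order is additive under concatenation, so both pieces of a word of order at most [m] have order
    at most [m]: the series supported on larger orders form an ideal. *)
Lemma agree_mul m a a' b b' :
  agree m a a' -> agree m b b' -> agree m (tmul a b) (tmul a' b').
Proof.
move=> aa' bb' w ordw; apply: eq_bigr => i _.
move: ordw; rewrite -{1}(cat_take_drop i w) word_order_cat => ordw.
rewrite aa'; last exact: leq_trans (leq_addr _ _) ordw.
by rewrite bb'//; exact: leq_trans (leq_addl _ _) ordw.
Qed.

Lemma agree_pow m a b k : agree m a b -> agree m (tpow a k) (tpow b k).
Proof. by move=> ab; elim: k => [//|k IH]; apply: agree_mul. Qed.

Lemma agree_sym m a b : agree m a b -> agree m b a.
Proof. by move=> ab w /ab ->. Qed.

Lemma tmulZl (c : R) a b : tmul (c *: a) b = c *: tmul a b.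
Proof.
apply/funext => w; change (tmul (c *: a) b w = c * tmul a b w).
by rewrite /tmul big_distrr; apply: eq_bigr => i _; rewrite [RHS]mulrA.
Qed.

Lemma tmulZr (c : R) a b : tmul a (c *: b) = c *: tmul a b.
Proof.
apply/funext => w; change (tmul a (c *: b) w = c * tmul a b w).
by rewrite /tmul big_distrr; apply: eq_bigr => i _; rewrite [RHS]mulrCA.
Qed.

Lemma tpowZ (c : R) a k : tpow (c *: a) k = c ^+ k *: tpow a k.
Proof.
elim: k => [|k IH]; first by rewrite expr0 scale1r.
by rewrite /tpow iterS -/(tpow _ k) IH tmulZl tmulZr scalerA -exprS.
Qed.

End Series.

Section TrieSeries.
Variables (R : realType) (th zs : nat -> R).
Hypothesis th3 : forall i, th i ^+ 2 = 3.
Notation pev := (zpoly_eval th zs).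
Notation tev := (trie_eval th zs : trie -> tseries R 3).

Lemma trie_bracket_agree m s t a b : agree m (tev s) a -> agree m (tev t) b ->
  agree m (tev (trie_bracket m s t)) (tbracket a b).
Proof.
move=> sa tb w ordw; rewrite trie_eval_add trie_eval_scale// !trie_eval_mul//.
rewrite zpoly_eval_opp// zpoly_eval_nat mulN1r.
by rewrite (agree_mul sa tb)// (agree_mul tb sa).
Qed.

Lemma trie_left_bracket_agree m (c : 'I_4) (l : seq 'I_4) :
  agree m (tev (trie_left_bracket m c [seq val e | e <- l])) (left_bracket c l).
Proof.
rewrite /trie_left_bracket /left_bracket.
have : agree m (tev (trie_eps c)) (eps c) by move=> w _; rewrite trie_eval_eps.
elim: l (trie_eps c) (eps c) => [//|e l IH] s a sa; apply: IH.
by apply: trie_bracket_agree => // w _; rewrite trie_eval_eps.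
Qed.

Lemma trie_series_eval m t u j cs w :
    agree m (tev u) (tpow (tev t) j) -> (word_order w <= m)%N ->
  tev (trie_series m t u cs) w
  = \sum_(k < size cs) zr R (nth Z0 cs k) * tpow (tev t) (j + k) w.
Proof.
move=> + ordw; elim: cs u j => [|c cs IH] u j uj; first by rewrite big_ord0.
rewrite trie_eval_add trie_eval_scale// zpoly_eval_const uj// big_ord_recl addn0.
congr (_ + _); rewrite (IH _ j.+1); last first.
  by move=> v ordv; rewrite trie_eval_mul//; apply: (agree_mul _ uj).
by apply: eq_bigr => k _; rewrite addSnnS.
Qed.

(** The condition on [cs] makes its k-th coefficient times [N ^ k] equal to [K / k!], so the series
    in [N *: a] is [K] times the exponential of [a]. Finitely many coefficients suffice: without
    constant term, [a ^ k] vanishes on words shorter than [k], and a word is no longer than its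
    order. *)
Lemma texp_trie m t cs (N K : R) (a : tseries R 3) w :
    agree m (N *: a) (tev t) -> a [::] = 0 -> (m < size cs)%N ->
    (forall k, (k < size cs)%N -> zr R (nth Z0 cs k) * N ^+ k * k`!%:R = K) ->
    (word_order w <= m)%N ->
  tev (trie_series m t (trie_const (Zpos xH)) cs) w = K * texp a w.
Proof.
move=> at_ a0 ltm csK ordw; rewrite (trie_series_eval (j := 0)) => [|v _|//]; last first.
  by rewrite trie_eval_const mul1r.
have ltw : (size w < size cs)%N.
  by apply: leq_ltn_trans ltm; apply: leq_trans ordw; apply: size_le_word_order.
rewrite /texp (big_ord_widen _ (fun k => (k`!%:R)^-1 * tpow a k w) ltw) big_distrr /=.
rewrite [RHS]big_mkcond /=; apply: eq_bigr => k _.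
rewrite -(agree_pow k at_)// tpowZ.
change ((N ^+ k *: tpow a k) w) with (N ^+ k * tpow a k w).
case: ltnP => [_|ltk]; last by rewrite tpow_short// !mulr0.
have fk : (k`!%:R : R) != 0 by rewrite pnatr_eq0 -lt0n fact_gt0.
by rewrite -(csK k (ltn_ord k)); field.
Qed.

End TrieSeries.

(** * Means and parity *)

(** For [n = 7], monomials whose mean the two cubature formulas determine. Only the degree in [z] is
    bounded by [n], as the exponents of the four [theta_i] are already reduced to 0 or 1. *)
Definition monomial_fits (n : nat) (m : monomial) : bool :=
  [&& size m.1 <= 4, size m.2 <= 3 & sumn m.2 <= n]%N.

(* [theta 0] is left out: the symmetry changes the signs of the other variables. *)
Definition monomial_degree (m : monomial) : nat :=
  (sumn m.2 + count id (behead m.1))%N.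

Definition monomial_graded (n : nat) (m : monomial) : bool :=
  monomial_fits n m && (odd (monomial_degree m) == odd n).

(** [n] is the order of the prefix leading to [t]. *)
Fixpoint trie_graded (n : nat) (t : trie) : bool :=
  if t is Node p t0 t1 t2 t3 then
    [&& all (fun u => monomial_graded n u.2) p, trie_graded n.+2 t0,
        trie_graded n.+1 t1, trie_graded n.+1 t2 & trie_graded n.+1 t3]
  else true.

Fixpoint trie_all (P : pred zpoly) (t : trie) : bool :=
  if t is Node p t0 t1 t2 t3 then
    [&& P p, trie_all P t0, trie_all P t1, trie_all P t2 & trie_all P t3]
  else true.

Fixpoint gaussian_moment (k : nat) : nat :=
  match k with 0 => 1 | 1 => 0 | (k''.+1 as k').+1 => k' * gaussian_moment k'' end.

Definition monomial_mean (m : monomial) : nat :=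
  if has id m.1 then 0%N else foldr (fun k => muln (gaussian_moment k)) 1%N m.2.

Definition zpoly_mean (p : zpoly) : Z :=
  foldr (fun u => Z.add (Z.mul u.1 (Z.of_nat (monomial_mean u.2)))) Z0 p.

Lemma sumn_exponent_add a b : sumn (exponent_add a b) = (sumn a + sumn b)%N.
Proof.
by elim: a b => [|i a IH] [|j b] //=; rewrite ?addn0// IH addnACA.
Qed.

Lemma size_exponent_add a b : size (exponent_add a b) = maxn (size a) (size b).
Proof. by elim: a b => [|i a IH] [|j b] //=; rewrite IH maxnSS. Qed.

Lemma size_sign_add a b : size (sign_add a b) = maxn (size a) (size b).
Proof. by elim: a b => [|i a IH] [|j b] //=; rewrite IH maxnSS. Qed.

Lemma odd_count_sign_add a b :
  odd (count id (sign_add a b)) = odd (count id a) (+) odd (count id b).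
Proof.
elim: a b => [|i a IH] [|j b] //=; first by rewrite addbF.
by rewrite !oddD IH !oddb addbACA.
Qed.

(** Reducing [theta_i ^ 2] to a constant lowers the degree by 2 and so preserves its parity. *)
Lemma monomial_graded_mul a b m n : monomial_graded a m -> monomial_graded b n ->
  monomial_graded (a + b) (monomial_mul m n).
Proof.
rewrite /monomial_graded /monomial_fits /monomial_degree /=.
move=> /andP[/and3P[m1 m2 ma] /eqP mo] /andP[/and3P[n1 n2 nb] /eqP no].
rewrite size_sign_add size_exponent_add sumn_exponent_add !geq_max m1 m2 n1 n2 leq_add//=.
rewrite [odd (a + b)]oddD -mo -no !oddD.
have -> : odd (count id (behead (sign_add m.1 n.1))) =
          odd (count id (behead m.1)) (+) odd (count id (behead n.1)).
  by case: (m.1) (n.1) => [|i u] [|j v] //=; rewrite ?addbF// odd_count_sign_add.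
by apply/eqP; rewrite addbACA.
Qed.

Lemma gaussian_moment_odd k : odd k -> gaussian_moment k = 0%N.
Proof.
have [n] := ubnP k; elim: n k => [//|n IH] [|[|k]] //=; rewrite negbK ltnS => kn ok.
by rewrite IH ?muln0// ltnW.
Qed.

(** Either some [theta_i] remains and has mean 0, or the degree in [z] is odd, so that some [z_i]
    has an odd exponent and a vanishing Gaussian moment. *)
Lemma monomial_mean_odd m : odd (monomial_degree m) -> monomial_mean m = 0%N.
Proof.
rewrite /monomial_degree /monomial_mean; case: ifPn => // nm.
have -> : count id (behead m.1) = 0%N.
  apply/eqP; rewrite -leqn0 leqNgt -has_count; apply: contra nm.
  by case: (m.1) => //= b s ->; rewrite orbT.
rewrite addn0; elim: (m.2) => [//|k s IH] /=; rewrite oddD.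
case: (boolP (odd k)) => [/gaussian_moment_odd ->//|_ /= /IH ->]; exact: muln0.
Qed.

(** * Graded functions on the nodes *)

Section Family.
Variables (R : realType) (I : Type) (th zs : I -> nat -> R).
Hypothesis th3 : forall p i, th p i ^+ 2 = 3.

(** The span of the graded monomials, taken as functions on the nodes. In this form the property
    passes from a series to its exponential without computing the exponential. *)
Inductive graded (n : nat) : (I -> R) -> Prop :=
| graded0 : graded n (fun=> 0)
| gradedD f g : graded n f -> graded n g -> graded n (fun p => f p + g p)
| gradedZ c f : graded n f -> graded n (fun p => c * f p)
| graded_monomial m : monomial_graded n m ->
    graded n (fun p => monomial_eval (th p) (zs p) m).

Lemma eq_graded n f g : f =1 g -> graded n f -> graded n g.
Proof. by move=> /funext ->. Qed.

Lemma graded_sum n (J : Type) (r : seq J) (F : J -> I -> R) :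
  (forall j, graded n (F j)) -> graded n (fun p => \sum_(j <- r) F j p).
Proof.
move=> gF; elim: r => [|j r IH].
  by apply: eq_graded (graded0 n) => p; rewrite big_nil.
by apply: eq_graded (gradedD (gF j) IH) => p; rewrite big_cons.
Qed.

Lemma gradedM a b f g : graded a f -> graded b g -> graded (a + b) (fun p => f p * g p).
Proof.
move=> gf gg; elim: gf => [|f1 f2 _ IH1 _ IH2|c f1 _ IH|m gm].
- by apply: eq_graded (graded0 _) => p; rewrite mul0r.
- by apply: eq_graded (gradedD IH1 IH2) => p; rewrite mulrDl.
- by apply: eq_graded (gradedZ c IH) => p; rewrite mulrA.
elim: gg => [|g1 g2 _ IH1 _ IH2|c g1 _ IH|n gn].
- by apply: eq_graded (graded0 _) => p; rewrite mulr0.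
- by apply: eq_graded (gradedD IH1 IH2) => p; rewrite mulrDr.
- by apply: eq_graded (gradedZ c IH) => p; rewrite mulrCA.
apply: eq_graded (gradedZ (zr R (sign_carry m.1 n.1))
         (graded_monomial (monomial_graded_mul gm gn))) => p.
by rewrite monomial_evalM.
Qed.

Lemma trie_graded_eval n t w : trie_graded n t ->
  graded (n + word_order w) (fun p => trie_eval (th p) (zs p) t w).
Proof.
elim: t n w => [|q t0 IH0 t1 IH1 t2 IH2 t3 IH3] n w; first by move=> _; exact: graded0.
move=> /and5P[gq g0 g1 g2 g3]; case: w => [|c w].
  rewrite [word_order _]big_nil addn0 /=.
  elim: q gq {g0 g1 g2 g3} => [_|u q IH /= /andP[gu gq]].
    by apply: eq_graded (graded0 _) => p; rewrite /zpoly_eval big_nil.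
  apply: eq_graded (gradedD (gradedZ (zr R u.1) (graded_monomial gu)) (IH gq)) => p.
  by rewrite /zpoly_eval big_cons.
rewrite word_order_cons addnA.
elim/letterP: c => /=; rewrite ?addn1 ?addn2; [exact: IH0|exact: IH1|exact: IH2|exact: IH3].
Qed.

Definition graded_series d m (a : I -> tseries R d) : Prop :=
  forall w, (word_order w <= m)%N -> graded (word_order w) (fun p => a p w).

Lemma graded_tmul d m (a b : I -> tseries R d) :
  graded_series m a -> graded_series m b -> graded_series m (fun p => tmul (a p) (b p)).
Proof.
move=> ga gb w ordw; apply: graded_sum => i.
have e : word_order w = (word_order (take i w) + word_order (drop i w))%N.
  by rewrite -word_order_cat cat_take_drop.
rewrite e; apply: gradedM; [apply: ga|apply: gb]; apply: leq_trans ordw; rewrite e.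
  exact: leq_addr.
exact: leq_addl.
Qed.

Lemma graded_texp d m (a : I -> tseries R d) :
  graded_series m a -> graded_series m (fun p => texp (a p)).
Proof.
move=> ga.
have gpow k : graded_series m (fun p => tpow (a p) k).
  elim: k => [|k IH]; last exact: graded_tmul.
  move=> w _; case: w => [|c w]; last first.
    by apply: eq_graded (graded0 _) => p; rewrite /tone.
  have g1 : monomial_graded 0 ([::], [::]) by [].
  rewrite [word_order _]big_nil; apply: eq_graded (graded_monomial g1) => p.
  by rewrite /monomial_eval /sign_eval /= mulr1.
by move=> w ordw; apply: graded_sum => k; apply: gradedZ; exact: gpow.
Qed.

End Family.

Section Expectation.
Variables (R : realType) (I : finType) (th zs : I -> nat -> R) (wt : I -> R) (N : nat).
Hypothesis mean_monomial : forall m, monomial_fits N m ->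
  \sum_p wt p * monomial_eval (th p) (zs p) m = (monomial_mean m)%:R.

Lemma mean_poly q : all (fun u => monomial_fits N u.2) q ->
  \sum_p wt p * zpoly_eval (th p) (zs p) q = zr R (zpoly_mean q).
Proof.
elim: q => [_|u q IH /= /andP[fu fq]].
  by apply: big1 => p _; rewrite zpoly_eval_nil mulr0.
rewrite zrD zrM -IH// zr_nat.
rewrite -mean_monomial// big_distrr -big_split; apply: eq_bigr => p _ /=.
by case: u {fu} => c m; rewrite zpoly_eval_cons /=; ring.
Qed.

(** A word outside the trie evaluates to 0, so checking the stored coefficients settles every
    word. *)
Lemma mean_trie t w :
  trie_all (fun q => all (fun u => monomial_fits N u.2) q && Z.eqb (zpoly_mean q) Z0) t ->
  \sum_p wt p * trie_eval (th p) (zs p) t w = 0.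
Proof.
elim: t w => [|q t0 IH0 t1 IH1 t2 IH2 t3 IH3] w.
  by move=> _; apply: big1 => p _; rewrite trie_eval_leaf mulr0.
move=> /and5P[/andP[fq /Z.eqb_spec q0] g0 g1 g2 g3].
case: w => [|c w] /=; first by rewrite mean_poly// q0.
by elim/letterP: c => /=; [exact: IH0|exact: IH1|exact: IH2|exact: IH3].
Qed.

Lemma mean_graded_odd n f : odd n -> (n <= N)%N -> graded th zs n f ->
  \sum_p wt p * f p = 0.
Proof.
move=> on nN; elim=> [|f1 f2 _ IH1 _ IH2|c f1 _ IH|m /andP[/and3P[s1 s2 sn] /eqP om]].
- by apply: big1 => p _; rewrite mulr0.
- by under eq_bigr do rewrite mulrDr; rewrite big_split /= IH1 IH2 addr0.
- by under eq_bigr do rewrite mulrCA; rewrite -big_distrr /= IH mulr0.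
rewrite mean_monomial; last by rewrite /monomial_fits s1 s2 (leq_trans sn).
by rewrite monomial_mean_odd// om.
Qed.

End Expectation.

(** * The integral form of the Lie polynomials *)

Definition trie_sum3 (P : pred nat) (F : nat -> trie) : trie :=
  foldr (fun i => trie_add (if P i then F i else Leaf)) Leaf [:: 0; 1; 2]%N.

(* [1080 *: wiener_lie3 z eta] up to order 7, in the variables [z] and
   [theta = sqrt 3 * eta] *)
Definition lie3_trie : trie :=
  let i1 := 0%N in let i2 := 1%N in let i3 := 2%N in
  let C := zpoly_nat in
  let M := zpoly_mul in
  let Z := zpoly_z in
  let h0 := zpoly_theta 0 in
  let h i := zpoly_theta i.+1 in
  let scale := trie_scale 7 in
  let opp := scale (zpoly_opp (C 1)) in
  let add := trie_add in
  let br i l := trie_left_bracket 7 i.+1 (map S l) in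
  let br0 l := trie_left_bracket 7 0 (map S l) in
  let sum := trie_sum3 in
  let all := xpredT in
  foldl add (scale (C 1080%N) (trie_eps 0)) [::
   scale (C 1080) (sum all (fun i => scale (Z i) (trie_eps i.+1)));
   scale (M (C 60) (M (h i1) (h i2)))
    (add (add (scale (Z i1) (br i1 [:: i2; i2])) (scale (Z i2) (br i2 [:: i3; i3])))
         (scale (Z i3) (br i3 [:: i1; i1])));
   scale (M (C 60) (M (h i1) (h i3)))
    (add (add (scale (Z i1) (br i1 [:: i3; i3])) (scale (Z i2) (br i2 [:: i1; i1])))
         (scale (Z i3) (br i3 [:: i2; i2])));
   scale (M (C 60) (M (h i2) (h i3)))
    (add (add (scale (Z i1) (br i1 [:: i2; i3])) (scale (Z i2) (br i2 [:: i3; i1])))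
         (scale (Z i3) (br i3 [:: i1; i2])));
   scale (C 90) (sum all (fun i => br0 [:: i; i]));
   scale (zpoly_add (M (C 60) (M (h i1) (M (h i2) h0)))
     (M (C 180) (zpoly_add (zpoly_opp (M (h i2) (Z i1))) (M (h i1) (Z i2)))))
     (br i1 [:: i2]);
   scale (zpoly_add (M (C 60) (M (h i1) (M (h i3) h0)))
     (M (C 180) (zpoly_add (M (h i3) (Z i1)) (M (h i1) (Z i3)))))
     (br i1 [:: i3]);
   scale (zpoly_add (M (C 60) (M (h i2) (M (h i3) h0)))
     (M (C 180) (zpoly_add (M (h i3) (Z i2)) (M (h i2) (Z i3)))))
     (br i2 [:: i3]);
   scale (C 180)
     (add (add (scale (h i3) (br0 [:: i3])) (opp (scale (h i2) (br0 [:: i2]))))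
          (opp (scale (h i1) (br0 [:: i1]))));
   scale (M (C 5) h0)
     (sum all (fun i => sum (fun j => i < j)%N (fun j =>
       sum (fun k => (i != k) && (k != j)) (fun k =>
         scale (M (h i) (h j))
           (add (add (br k [:: j; k; i]) (br i [:: j; k; k])) (br i [:: k; k; j]))))));
   scale (M (C 10) h0)
     (sum all (fun i => sum (fun j => i < j)%N (fun j =>
         scale (M (h i) (h j)) (add (br i [:: j; j; j]) (br i [:: j; i; i])))));
   scale (C 90)
     (sum all (fun i => sum (fun j => i != j) (fun j =>
       scale (Z i) (br i [:: j; j]))));
   scale (C 3)
     (sum all (fun i => sum (fun j => i < j)%N (fun j => sum (fun k => j < k)%N (fun k =>
       foldl add (scale (Z i) (br j [:: k; k; j; i])) [::
         scale (Z k) (br i [:: j; j; k; i]);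
         scale (Z i) (br k [:: i; j; j; k]); scale (Z k) (br j [:: i; i; k; j]);
         scale (Z j) (br k [:: j; i; i; k]); scale (Z j) (br i [:: k; k; i; j])]))));
   scale (C 6)
     (sum all (fun i => sum (fun j => i < j)%N (fun j => sum (fun k => j < k)%N (fun k =>
       foldl add (scale (Z j) (br k [:: i; i; j; k])) [::
         scale (Z i) (br k [:: j; j; i; k]);
         scale (Z k) (br j [:: k; i; i; j]); scale (Z k) (br i [:: k; j; j; i])]))));
   scale (C 9)
     (sum all (fun i => sum (fun j => i < j)%N (fun j => sum (fun k => j < k)%N (fun k =>
       add (scale (Z i) (br j [:: i; k; k; j])) (scale (Z j) (br i [:: j; k; k; i]))))));
   scale (C 9)
     (sum all (fun i => sum all (fun j =>
        sum (fun k => [&& i != j, j != k & i != k]) (fun k =>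
          scale (Z i) (br i [:: k; k; j; j])))));
   scale (C 3)
     (sum all (fun i => sum (fun j => i != j) (fun j =>
       scale (Z i) (br i [:: j; j; j; j]))));
   scale (C 9)
     (sum all (fun i => sum (fun j => i != j) (fun j =>
       scale (Z j) (br i [:: j; j; j; i]))));
   scale (C 12)
     (sum all (fun i => sum (fun j => i != j) (fun j =>
       scale (Z i) (br i [:: j; i; j; i]))));
   scale (C 3) (sum all (fun i => br0 [:: i; i; i; i]));
   scale (C 9) (sum all (fun i => sum (fun j => i != j) (fun j => br0 [:: i; i; j; j])));
   scale (C 6) (sum all (fun i => sum (fun j => i != j) (fun j =>
     trie_left_bracket 7 j.+1 [:: 0; i.+1; i.+1; j.+1])));
   scale (C 3) (sum all (fun i => sum (fun j => i != j) (fun j =>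
     trie_left_bracket 7 i.+1 [:: j.+1; j.+1; 0; i.+1])))]%N.

(** The factor 1080, the same as for [lie3_trie], gives both exponentials the same multiple and
    makes them comparable. *)
Definition generator_trie : trie :=
  trie_add (trie_scale 7 (zpoly_nat 1080) (trie_eps 0))
    (trie_scale 7 (zpoly_nat 540)
       (trie_sum3 xpredT (fun i => trie_mul 7 (trie_eps i.+1) (trie_eps i.+1)))).

(** The k-th entry is [n! / k!] times [c ^ (n - k)]: applied to the powers of [c a], these integers
    give [n! c ^ n] times the exponential of [a] up to degree [n]. *)
Definition exp_coefs (n : nat) (c : Z) : seq Z :=
  [seq Z.mul (Z.of_nat (n ^_ (n - k))) (iter (n - k) (Z.mul c) (Zpos xH))
     | k <- iota 0 n.+1].

Lemma exp_coefsP (R : realType) n c k : (k <= n)%N ->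
  zr R (nth Z0 (exp_coefs n c) k) * zr R c ^+ k * k`!%:R = n`!%:R * zr R c ^+ n.
Proof.
move=> kn; rewrite (nth_map 0%N) ?size_iota ?ltnS// nth_iota ?ltnS// add0n zrM zr_nat.
have -> : zr R (iter (n - k) (Z.mul c) (Zpos xH)) = zr R c ^+ (n - k).
  by elim: (n - k)%N => [//|j IH]; rewrite iterS zrM IH exprS.
have -> : zr R c ^+ n = zr R c ^+ (n - k) * zr R c ^+ k by rewrite -exprD subnK.
have -> : n`!%:R = (n ^_ (n - k))%:R * k`!%:R :> R.
  by rewrite -natrM -[X in (_ * X`!)%N](subKn kn) ffact_fact// leq_subr.
ring.
Qed.

Definition difference_trie : trie :=
  let texp t := trie_series 6 t (trie_const (Zpos xH)) (exp_coefs 6 (Z.of_nat 1080)) in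
  trie_add (texp lie3_trie) (trie_scale 6 (zpoly_opp (zpoly_nat 1)) (texp generator_trie)).

Lemma lie3_trie_graded : trie_graded 0 lie3_trie.
Proof. by vm_compute. Qed.

Lemma generator_trie_graded : trie_graded 0 generator_trie.
Proof. by vm_compute. Qed.

(** The algebraic content of the formula up to order 6, in exact integer arithmetic. The
    coefficients themselves need not vanish as polynomials; their means do. *)
Lemma difference_trie_mean :
  trie_all (fun q => all (fun u => monomial_fits 7 u.2) q && Z.eqb (zpoly_mean q) Z0)
    difference_trie.
Proof. by vm_compute. Qed.

(** * Agreement of the tries with the series they encode *)

Section Link.
Variables (R : realType) (th zs : nat -> R).
Hypothesis th3 : forall i, th i ^+ 2 = 3.
Notation pev := (zpoly_eval th zs).
Notation tev := (trie_eval th zs : trie -> tseries R 3).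
Implicit Types (a b : tseries R 3) (s t : trie).

Lemma agree_trieD (k : R) a b s t : agree 7 (k *: a) (tev s) -> agree 7 (k *: b) (tev t) ->
  agree 7 (k *: (a + b)) (tev (trie_add s t)).
Proof.
by move=> sa tb w ordw; rewrite scalerDr trie_eval_add -sa// -tb.
Qed.

Lemma agree_trieN (k : R) b t : agree 7 (k *: b) (tev t) ->
  agree 7 (k *: - b) (tev (trie_scale 7 (zpoly_opp (zpoly_nat 1)) t)).
Proof.
move=> tb w ordw.
by rewrite trie_eval_scale// zpoly_eval_opp// zpoly_eval_nat mulN1r -tb// scalerN.
Qed.

(** The scale may change from [k] to [k'] under a coefficient, so denominators and factors [sqrt 3]
    are all settled in the numerical side conditions. *)
Lemma agree_trieZ (k' k c : R) a p t : agree 7 (k' *: a) (tev t) -> pev p * k' = k * c ->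
  agree 7 (k *: (c *: a)) (tev (trie_scale 7 p t)).
Proof.
by move=> ta pk w ordw; rewrite trie_eval_scale// -ta// scalerA -pk -scalerA.
Qed.

Lemma agree_trie_scale (k' k : R) a p t : agree 7 (k' *: a) (tev t) -> pev p * k' = k ->
  agree 7 (k *: a) (tev (trie_scale 7 p t)).
Proof.
by move=> ta pk w ordw; rewrite trie_eval_scale// -ta// -pk -scalerA.
Qed.

Lemma agree_trie_sum3 (k : R) (P : pred nat) (Q : pred 'I_3) (F : nat -> trie)
    (G : 'I_3 -> tseries R 3) :
  (forall i : 'I_3, Q i = P i) ->
  (forall i : 'I_3, P i -> agree 7 (k *: G i) (tev (F i))) ->
  agree 7 (k *: \sum_(i < 3 | Q i) G i) (tev (trie_sum3 P F)).
Proof.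
move=> QP FG w ordw; rewrite /trie_sum3 /=.
have e (i : 'I_3) : (k *: (if Q i then G i else 0)) w = tev (if P i then F i else Leaf) w.
  rewrite QP; case: ifP => [Pi|_]; first exact: FG.
  by rewrite scaler0 trie_eval_leaf.
rewrite !trie_eval_add big_mkcond scaler_sumr !big_ord_recl big_ord0.
by rewrite -(e ord0) -(e (lift ord0 ord0)) -(e (lift ord0 (lift ord0 ord0))) trie_eval_leaf.
Qed.

Lemma agree_trie_left_bracket (c : 'I_4) (l : seq 'I_4) c' l' :
  c' = val c -> l' = [seq val e | e <- l] ->
  agree 7 (1 *: left_bracket c l) (tev (trie_left_bracket 7 c' l')).
Proof.
by move=> -> ->; rewrite scale1r; apply: agree_sym; apply: trie_left_bracket_agree.
Qed.

Lemma agree_trie_eps (c : 'I_4) c' : c' = val c ->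
  agree 7 (1 *: eps c) (tev (trie_eps c')).
Proof. by move=> -> w _; rewrite scale1r trie_eval_eps. Qed.

End Link.

Section Lie3.
Local Opaque trie_add trie_scale trie_sum3 trie_left_bracket trie_mul trie_eps
  zpoly_mul zpoly_add zpoly_opp zpoly_nat zpoly_z zpoly_theta.

(** Descends both expressions in parallel; the operations are opaque so that unification compares
    shapes and never computes a trie. [k] is the scale chosen for the body of a scaling. *)
Ltac agree_step th3 k :=
  lazymatch goal with
  | |- agree _ _ (trie_eval _ _ (trie_add _ _)) => apply: agree_trieD
  | |- agree _ _ (trie_eval _ _ (trie_sum3 _ _)) =>
      apply: agree_trie_sum3 => [//|? ?]
  | |- agree _ _ (trie_eval _ _ (trie_left_bracket _ _ _)) =>
      apply: agree_trie_left_bracket => //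
  | |- agree _ _ (trie_eval _ _ (trie_eps _)) => apply: agree_trie_eps => //
  | |- agree _ (_ *: - _) _ => apply: (agree_trieN th3)
  | |- agree _ (_ *: (_ *: _)) _ => apply: (agree_trieZ th3 (k' := k))
  | |- agree _ _ (trie_eval _ _ (trie_scale _ _ _)) =>
      apply: (agree_trie_scale th3 (k' := k))
  end.

Lemma lie3_trie_agree (R : realType) (z : 3.-tuple R) (eta : 4.-tuple R)
    (th zs : nat -> R) :
    (forall i, th i ^+ 2 = 3) ->
    (forall i, (i < 4)%N -> th i = Num.sqrt 3 * nth 0 eta i) ->
    (forall i, (i < 3)%N -> zs i = nth 0 z i) ->
  agree 7 (1080 *: wiener_lie3 z eta) (trie_eval th zs lie3_trie).
Proof.
move=> th3 thE zsE; rewrite /wiener_lie3.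
cbv beta iota zeta delta [lie3_trie foldl].
set s3 := Num.sqrt 3 in thE *.
have s33 : s3 ^+ 2 = 3 by rewrite sqr_sqrtr.
have s30 : s3 != 0 by rewrite sqrtr_eq0 -ltNge.
have s3i : s3^-1 = s3 / 3 by rewrite -s33; field.
repeat (apply: agree_trieD).
(* The bodies of summands 11 and 12 contain [eta_i eta_j], encoded as
   [theta_i theta_j = 3 eta_i eta_j]; that of summand 10 contains single [eta_i], encoded as
   [sqrt 3 * eta_i]. *)
11,12: agree_step th3 (3 : R).
10: agree_step th3 s3.
all: repeat agree_step th3 (1 : R).
all: rewrite ?(zpoly_eval_add, zpoly_eval_opp, zpoly_eval_mul, zpoly_eval_nat,
  zpoly_eval_theta, zpoly_eval_z)// ?(tnth_nth 0) ?thE ?zsE//=.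
all: rewrite /bump ?add1n ?mul1r ?mulr1 ?invfM ?s3i//.
all: try by rewrite ltnS.
all: by field: s33.
Qed.

Lemma generator_trie_agree (R : realType) (th zs : nat -> R) :
    (forall i, th i ^+ 2 = 3) ->
  agree 7 (1080 *: (eps ord0
        + 2^-1 *: \sum_(i < 3) tmul (eps (lift ord0 i)) (eps (lift ord0 i))))
    (trie_eval th zs generator_trie).
Proof.
move=> th3; rewrite /generator_trie; apply: agree_trieD.
  by agree_step th3 (1 : R); [agree_step th3 (1 : R)|rewrite zpoly_eval_nat mulr1].
agree_step th3 (1 : R); last by rewrite zpoly_eval_nat; field.
apply: agree_trie_sum3 => [//|i _] w ordw.
by rewrite trie_eval_mul// scale1r -(trie_eval_eps th zs (lift ord0 i)).
Qed.

End Lie3.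

(** * Lie polynomials *)

Section LiePolynomials.
Variables (R : realType) (d : nat).
Implicit Types (a b : tseries R d) (w : seq 'I_d.+1).

Lemma lie_polynomial0 : lie_polynomial (0 : tseries R d).
Proof.
exists 0%N, (fun=> 0), (fun=> eps ord0); split; last by rewrite big_ord0.
by case.
Qed.

Lemma lie_polynomialD a b : lie_polynomial a -> lie_polynomial b -> lie_polynomial (a + b).
Proof.
move=> [n [c [u [uP ->]]]] [n' [c' [u' [uP' ->]]]].
exists (n + n')%N,
  (fun i : 'I_(n + n') => match fintype.split i with inl j => c j | inr j => c' j end),
  (fun i : 'I_(n + n') => match fintype.split i with inl j => u j | inr j => u' j end);
  split.
  by move=> i; case: (fintype.split i).
rewrite big_split_ord /=; congr (_ + _); apply: eq_bigr => i _.
  by rewrite (unsplitK (inl i)).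
by rewrite (unsplitK (inr i)).
Qed.

Lemma lie_polynomialZ (k : R) a : lie_polynomial a -> lie_polynomial (k *: a).
Proof.
move=> [n [c [u [uP ->]]]]; exists n, (fun i => k * c i), u; split => //.
by rewrite scaler_sumr; apply: eq_bigr => i _; rewrite scalerA.
Qed.

Lemma iterated_bracket_lie a : iterated_bracket a -> lie_polynomial a.
Proof.
move=> ia; exists 1%N, (fun=> 1), (fun=> a); split => //.
by rewrite big_ord1 scale1r.
Qed.

Lemma left_bracket_iterated (c : 'I_d.+1) l :
  iterated_bracket (left_bracket c l : tseries R d).
Proof.
rewrite /left_bracket; have : iterated_bracket (eps c : tseries R d) by constructor.
by elim: l (eps c) => [//|e l IH] a ia /=; apply: IH; do 2?constructor.
Qed.

Definition homogeneous n a := forall w, a w != 0 -> word_order w = n.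

Lemma homogeneous_eps (c : 'I_d.+1) : homogeneous (word_order [:: c]) (eps c : tseries R d).
Proof. by move=> w; rewrite /eps pnatr_eq0 eqb0 negbK => /eqP ->. Qed.

Lemma homogeneous_tmul n n' a b :
  homogeneous n a -> homogeneous n' b -> homogeneous (n + n') (tmul a b).
Proof.
move=> ha hb w; apply: contraNeq => nw; apply/eqP/big1 => i _; apply/eqP.
apply: contraNT nw; rewrite mulf_eq0 negb_or => /andP[/ha <- /hb <-].
by rewrite -word_order_cat cat_take_drop.
Qed.

Lemma homogeneous_bracket n n' a b :
  homogeneous n a -> homogeneous n' b -> homogeneous (n + n') (tbracket a b).
Proof.
move=> ha hb w; apply: contraNeq => nw.
change (tmul a b w - tmul b a w == 0).
have /eqP -> : tmul a b w == 0 by apply: contraNT nw => /(homogeneous_tmul ha hb) ->.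
have /eqP -> : tmul b a w == 0.
  by apply: contraNT nw => /(homogeneous_tmul hb ha) ->; rewrite addnC.
by rewrite subr0.
Qed.

Lemma homogeneous_left_bracket (c : 'I_d.+1) l :
  homogeneous (word_order (c :: l)) (left_bracket c l : tseries R d).
Proof.
rewrite -cat1s word_order_cat /left_bracket.
elim: l (word_order _) (eps c : tseries R d) (@homogeneous_eps c) => [|e l IH] n a ha /=.
  by rewrite [word_order [::]]big_nil addn0.
rewrite -cat1s word_order_cat addnA; apply: IH.
exact: homogeneous_bracket (@homogeneous_eps e).
Qed.

Lemma lie_truncatedD m a b :
  lie_truncated m a -> lie_truncated m b -> lie_truncated m (a + b).
Proof.
move=> [a' la ->] [b' lb ->]; exists (a' + b'); first exact: lie_polynomialD.
apply/funext => w; change (tproj m a' w + tproj m b' w = tproj m (a' + b') w).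
by rewrite /tproj; case: ifP => // _; rewrite addr0.
Qed.

Lemma lie_truncatedZ m (k : R) a : lie_truncated m a -> lie_truncated m (k *: a).
Proof.
move=> [a' la ->]; exists (k *: a'); first exact: lie_polynomialZ.
apply/funext => w; change (k * tproj m a' w = tproj m (k *: a') w).
by rewrite /tproj; case: ifP => // _; rewrite mulr0.
Qed.

Lemma lie_truncatedN m a : lie_truncated m a -> lie_truncated m (- a).
Proof. by move=> la; rewrite -scaleN1r; apply: lie_truncatedZ. Qed.

Lemma lie_truncated_sum m (I : Type) (r : seq I) (P : pred I) (F : I -> tseries R d) :
  (forall i, lie_truncated m (F i)) -> lie_truncated m (\sum_(i <- r | P i) F i).
Proof.
move=> lF; apply: big_ind => //; last exact: lie_truncatedD.
exists 0; first exact: lie_polynomial0.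
by apply/funext => w; rewrite /tproj; case: ifP.
Qed.

(** The bracket is homogeneous, of the order of its letters, so truncation at [m] leaves it
    unchanged. *)
Lemma lie_truncated_left_bracket m (c : 'I_d.+1) l : (word_order (c :: l) <= m)%N ->
  lie_truncated m (left_bracket c l : tseries R d).
Proof.
move=> lm; exists (left_bracket c l).
  exact/iterated_bracket_lie/left_bracket_iterated.
apply/funext => w; rewrite /tproj; case: ifPn => //; apply: contraNeq.
by move=> /homogeneous_left_bracket ->.
Qed.

Lemma word_order_time l : word_order (ord0 :: l : seq 'I_d.+1) = (word_order l).+2.
Proof. by rewrite word_order_cons eqxx. Qed.

Lemma word_order_space (i : 'I_d) l : word_order (lift ord0 i :: l) = (word_order l).+1.
Proof. by rewrite word_order_cons eq_sym (negbTE (neq_lift _ _)). Qed.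

End LiePolynomials.

Lemma wiener_lie3_truncated (R : realType) (z : 3.-tuple R) (eta : 4.-tuple R) :
  lie_truncated 7 (wiener_lie3 z eta).
Proof.
have leps c : lie_truncated 7 (eps c : tseries R 3).
  apply: (@lie_truncated_left_bracket _ _ _ c [::]).
  by rewrite /word_order big_seq1; case: ifP.
rewrite /wiener_lie3.
repeat first [apply: lie_truncated_left_bracket | apply: lie_truncatedD
  | apply: lie_truncatedN | apply: lie_truncatedZ
  | apply: lie_truncated_sum => ? | exact: leps].
all: by rewrite /= ?(word_order_time, word_order_space) /word_order big_nil.
Qed.

(** * Moments of the normal distribution *)

Section GaussianMoments.
Import numFieldNormedType.Exports.
Local Open Scope classical_set_scope.
Variable R : realType.
Notation mu := (@lebesgue_measure R).
Notation pdf := (normal_pdf (0 : R) 1).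
Implicit Types (x : R) (k : nat).

(** The density coincides almost everywhere with the Radon-Nikodym derivative, as both have the same
    integral over every measurable set. *)
Lemma ge0_integral_normal_prob (f : measurableTypeR R -> \bar R) :
    measurable_fun setT f -> (forall x, (0 <= f x)%E) ->
  (\int[normal_prob 0 1]_x f x = \int[mu]_x (f x * (pdf x)%:E))%E.
Proof.
move=> mf f0.
have dom := @normal_prob_dominates R 0 1.
rewrite -(Radon_Nikodym_SigmaFinite.change_of_variables dom f0 measurableT mf).
have mg := measurable_int _ (Radon_Nikodym_SigmaFinite.f_integrable dom).
have mpdf : measurable_fun setT (fun x => (pdf x)%:E).
  by apply/measurable_EFinP; exact: measurable_normal_pdf.
apply: ae_eq_integral => //.
- exact: emeasurable_funM.
- exact: emeasurable_funM.
apply: ae_eqe_mul2l; apply: integral_ae_eq => //.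
  exact: Radon_Nikodym_SigmaFinite.f_integrable.
by move=> E _ mE; rewrite -Radon_Nikodym_SigmaFinite.f_integral.
Qed.

Lemma integral_normal_prob (f : measurableTypeR R -> \bar R) : measurable_fun setT f ->
  (\int[normal_prob 0 1]_x f x = \int[mu]_x (f x * (pdf x)%:E))%E.
Proof.
move=> mf; rewrite [LHS]integralE [RHS]integralE.
rewrite !ge0_integral_normal_prob//; [|exact: measurable_funeneg|exact: measurable_funepos].
have pdf0 x : (0 <= (pdf x)%:E)%E by rewrite lee_fin normal_pdf_ge0.
congr (_ - _)%E; apply: eq_integral => x _.
  by rewrite !funeposE muleC maxe_pMr// mule0 muleC.
by rewrite !funenegE muleC maxe_pMr// mule0 muleN muleC.
Qed.

Lemma pdfE x : pdf x = normal_peak 1 * expR (- (x ^+ 2 / 2)).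
Proof. by rewrite normal_pdfE ?oner_eq0// /normal_fun subr0 expr1n mulNr. Qed.

Lemma exprn_le_expR k (y : R) : 0 <= y -> y ^+ k <= k`!%:R * expR y.
Proof.
have kf n : 0 < n`!%:R :> R by rewrite ltr0n fact_gt0.
move=> y0; rewrite mulrC -ler_pdivrMr//.
case: k => [|k]; first by rewrite expr0 divr1 -expR0 ler_expR.
by apply: le_trans (expR_ge1Dxn k y0); rewrite lerDr.
Qed.

(** Half of the exponent absorbs the power: with [y = x ^ 2 / 4], [|x| ^ k <= 1 + (x ^ 2) ^ k] and
    [y ^ k <= k! exp y] bound [|x| ^ k] by [(1 + 4 ^ k k!) exp y]. What remains is a Gaussian of
    variance 2. The bound serves both integrability and decay at infinity. *)
Lemma pdf_moment_bound k : exists2 C : R, 0 <= C &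
  forall x, `|x ^+ k * pdf x| <= C * normal_pdf 0 (Num.sqrt 2) x.
Proof.
pose C := (1 + 4 ^+ k * k`!%:R) * normal_peak 1 / normal_peak (Num.sqrt 2) : R.
have pk0 (s : R) : s != 0 -> 0 < normal_peak s := @normal_peak_gt0 R s.
have s20 : Num.sqrt 2 != 0 :> R by rewrite sqrtr_eq0 -ltNge.
have C0 : 0 <= 1 + 4 ^+ k * k`!%:R :> R by rewrite addr_ge0// mulr_ge0// exprn_ge0.
exists C; first by rewrite /C !mulr_ge0// ?invr_ge0 ?normal_peak_ge0.
move=> x.
have -> : C * normal_pdf 0 (Num.sqrt 2) x =
    (1 + 4 ^+ k * k`!%:R) * normal_peak 1 * expR (- (x ^+ 2 / 4)).
  rewrite normal_pdfE// /normal_fun subr0 sqr_sqrtr// mulrA divfK ?gt_eqF ?pk0//.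
  by congr (_ * expR _); rewrite mulNr -mulrnA.
rewrite pdfE normrM (ger0_norm (mulr_ge0 _ _)) ?normal_peak_ge0 ?expR_ge0//.
rewrite mulrCA -[leRHS]mulrA [leRHS]mulrCA ler_wpM2l ?normal_peak_ge0//.
have -> : expR (- (x ^+ 2 / 2)) = expR (- (x ^+ 2 / 4)) * expR (- (x ^+ 2 / 4)) :> R.
  by rewrite -expRD; congr expR; field.
rewrite mulrA ler_wpM2r ?expR_ge0//.
have x20 : 0 <= x ^+ 2 / 4 by rewrite divr_ge0 ?sqr_ge0.
rewrite expRN -ler_pdivlMr ?invr_gt0 ?expR_gt0// invrK normrX.
apply: (@le_trans _ _ (1 + (x ^+ 2) ^+ k)).
  rewrite -[x ^+ 2]real_normK ?num_real// -exprM mulnC exprM.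
  have : 0 <= `|x| ^+ k by rewrite exprn_ge0.
  by move: (`|x| ^+ k) => a a0; nra.
set y := x ^+ 2 / 4 in x20 *.
have -> : x ^+ 2 = 4 * y by rewrite /y; field.
rewrite exprMn mulrDl mul1r -mulrA lerD//.
  by rewrite -expR0 ler_expR.
by rewrite ler_wpM2l ?exprn_ge0// exprn_le_expR.
Qed.

Lemma integrable_moment k : mu.-integrable [set: R] (fun x => (x ^+ k * pdf x)%:E).
Proof.
have [C C0 Cb] := pdf_moment_bound k.
apply: (le_integrable measurableT
  (g := fun x : measurableTypeR R => (C * normal_pdf 0 (Num.sqrt 2) x)%:E)).
- by apply/measurable_EFinP/measurable_funM => //; exact: measurable_normal_pdf.
- move=> x _; rewrite lee_fin (le_trans (Cb x))// ler_norm//.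
- under eq_fun do rewrite EFinM.
  by apply: integrableZl => //; exact: integrable_normal_pdf.
Qed.

(** The bound for exponent [k + 1], divided by [|u n| = n], leaves a constant over [n]. The
    hypothesis on [u] covers both ends of the line. *)
Lemma cvg_moment k (u : nat -> R) : (forall n, `|u n| = n%:R) ->
  u n ^+ k * pdf (u n) @[n --> \oo] --> (0 : R).
Proof.
move=> un; have [C C0 Cb] := pdf_moment_bound k.+1.
have s20 : Num.sqrt 2 != 0 :> R by rewrite sqrtr_eq0 -ltNge.
apply/norm_cvg0P.
have cC : (C * normal_peak (Num.sqrt 2)) * n.+1%:R^-1 @[n --> \oo] --> (0 : R).
  by rewrite -(mulr0 (C * normal_peak (Num.sqrt 2))); apply: cvgMr; exact: cvg_harmonic.
rewrite -(cvg_shiftS (fun n => `|u n ^+ k * pdf (u n)|)).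
apply: (squeeze_cvgr _ (cvg_cst 0) cC); near=> n.
rewrite normr_ge0 /= ler_pdivlMr// -(un n.+1) -normrM mulrC mulrA -exprS.
by rewrite (le_trans (Cb _))// ler_wpM2l// normal_pdf_ub.
Unshelve. all: by end_near. Qed.


(** The fundamental theorem of calculus on [[-n, n]], followed by dominated convergence with bound
    [|g|]. *)
Lemma integral_deriv0 (G g : R -> R) :
    (forall x, is_derive x 1 G (g x)) -> continuous g ->
    mu.-integrable [set: R] (EFin \o g) ->
    G n%:R @[n --> \oo] --> (0 : R) -> G (- n%:R) @[n --> \oo] --> (0 : R) ->
  (\int[mu]_x (g x)%:E = 0)%E.
Proof.
move=> dG cg ig G0 GN0.
pose A n : set R := `[- n%:R, n%:R]%classic.
have mg := measurable_int _ ig.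
have mA n : measurable (A n : set (measurableTypeR R)) by exact: measurable_itv.
pose f_ n : measurableTypeR R -> \bar R := (EFin \o g) \_ (A n).
have fE n : (0 < n)%N -> (\int[mu]_x f_ n x = (G n%:R - G (- n%:R))%:E)%E.
  move=> n0; rewrite -integral_mkcond EFinB; apply: continuous_FTC2.
  - by rewrite gtrN// ltr0n.
  - exact: continuous_subspaceT.
  - have cG x : G y @[y --> x] --> G x.
      by apply: differentiable_continuous; apply/derivable1_diffP; case: (dG x).
    split; first by move=> x _; case: (dG x).
      exact: cvg_at_right_filter.
    exact: cvg_at_left_filter.
  - by move=> x _; rewrite derive1E; case: (dG x).
have cvf x : f_ n x @[n --> \oo] --> (g x)%:E.
  apply: cvg_near_cst; near=> n; rewrite /f_ patchE mem_set//=.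
  have : `|x| <= n%:R by near: n; exact: nbhs_infty_ger.
  by rewrite /A /= in_itv /= ler_norml.
have mf n : measurable_fun setT (f_ n).
  by apply/measurable_restrict => //; rewrite setTI; exact: measurable_funTS.
have fle : {ae mu, forall x, forall n, setT x -> (`|f_ n x| <= (abse \o (EFin \o g)) x)%E}.
  apply: aeW => x n _; rewrite /f_ patchE; case: ifP => //= _.
  by rewrite normr0 lee_fin normr_ge0.
have cvf' : {ae mu, forall x, setT x -> f_ n x @[n --> \oo] --> (EFin \o g) x}.
  by apply: aeW => x _; exact: cvf.
have [_ _ cf] := dominated_convergence measurableT mf mg cvf' (integrable_abse ig) fle.
have c0 : (\int[mu]_x f_ n x)%E @[n --> \oo] --> (0 : \bar R)%E.
  (* The shift by one excludes the degenerate interval at [n = 0]. *)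
  rewrite -cvg_shiftS.
  rewrite (_ : [sequence _]_n = fun n => (G n.+1%:R - G (- n.+1%:R))%:E); last first.
    by apply/funext => n /=; rewrite fE.
  apply: cvg_EFin; first exact: nearW.
  rewrite -(subrr 0); apply: cvgB.
    by rewrite (cvg_shiftS (fun n => G n%:R)).
  by rewrite (cvg_shiftS (fun n => G (- n%:R))).
exact: (cvg_unique _ cf c0).
Unshelve. all: by end_near. Qed.

(** At [k = 0] the truncated predecessor in the exponent is harmless, since its factor [k] is 0. *)
Lemma is_derive_moment k x :
  is_derive x 1 (fun y => y ^+ k * pdf y)
    (k%:R * (x ^+ k.-1 * pdf x) - x ^+ k.+1 * pdf x).
Proof.
have dX n : is_derive x 1 (fun y : R => y ^+ n) (n%:R * x ^+ n.-1).
  have -> : (fun y : R => y ^+ n) = (@id R) ^+ n by apply/funext => y; rewrite fctE.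
  by apply: is_derive_eq; rewrite scaler1.
have dE : is_derive x 1 (expR \o (fun y : R => - 2^-1 * y ^+ 2))
    (- x * expR (- 2^-1 * x ^+ 2)).
  apply: is_derive_eq (is_derive1_comp (is_derive_expR _) (is_deriveZ (- 2^-1) (dX 2%N))) _.
  by rewrite /GRing.scale /= expr1; field.
have -> : (fun y => y ^+ k * pdf y) =
    (fun y : R => y ^+ k) * (normal_peak 1 *: (expR \o (fun y : R => - 2^-1 * y ^+ 2))).
  apply/funext => y.
  change (y ^+ k * pdf y = y ^+ k * (normal_peak 1 * expR (- 2^-1 * y ^+ 2))).
  by rewrite pdfE; congr (_ * (_ * expR _)); field.
apply: is_derive_eq (is_deriveM (dX k) (is_deriveZ (normal_peak 1) dE)) _.
rewrite pdfE (_ : - (x ^+ 2 / 2) = - 2^-1 * x ^+ 2); last by field.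
set e := expR _; rewrite [x ^+ k.+1]exprS.
change (x ^+ k * (normal_peak 1 * (- x * e)) + normal_peak 1 * e * (k%:R * x ^+ k.-1) =
  k%:R * (x ^+ k.-1 * (normal_peak 1 * e)) - x * x ^+ k * (normal_peak 1 * e)).
by move: e (x ^+ k) (x ^+ k.-1) => e a b; ring.
Qed.

(** Integrating the derivative of [x ^ n * pdf x] over the line gives [M_(n+1) = n M_(n-1)], the
    recursion of [gaussian_moment]. *)
Lemma integral_moment k : (\int[mu]_x (x ^+ k * pdf x)%:E = (gaussian_moment k)%:R%:E)%E.
Proof.
have iM n : mu.-integrable [set: R] (fun x => (n%:R * (x ^+ n.-1 * pdf x))%:E).
  under eq_fun do rewrite EFinM.
  by apply: integrableZl => //; exact: integrable_moment.
have rec n : (\int[mu]_x (n%:R * (x ^+ n.-1 * pdf x) - x ^+ n.+1 * pdf x)%:E = 0)%E.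
  have dn := is_derive_moment n.
  apply: (integral_deriv0 dn).
  - have c m : continuous (fun x => x ^+ m * pdf x).
      move=> x; apply: differentiable_continuous; apply/derivable1_diffP.
      by case: (is_derive_moment m x).
    move=> x; apply: cvgB; last exact: c.
    by apply: cvgMr; exact: c.
  - exact: (integrableB measurableT (iM n) (integrable_moment n.+1)).
  - by apply: cvg_moment => m; rewrite normr_nat.
  - by apply: cvg_moment => m; rewrite normrN normr_nat.
have rec' n : (\int[mu]_x (x ^+ n.+1 * pdf x)%:E =
    n%:R%:E * \int[mu]_x (x ^+ n.-1 * pdf x)%:E)%E.
  have := rec n; under eq_integral do rewrite EFinB.
  rewrite integralB//; last exact: integrable_moment.
  under [X in (X - _)%E]eq_integral do rewrite EFinM.
  rewrite integralZl//; last exact: integrable_moment.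
  have fin m : (\int[mu]_x (x ^+ m * pdf x)%:E)%E \is a fin_num.
    by apply: integrable_fin_num => //; exact: integrable_moment.
  rewrite -(fineK (fin n.-1)) -(fineK (fin n.+1)) -EFinM -EFinB => -[] /eqP.
  by rewrite subr_eq0 => /eqP ->.
have [n] := ubnP k; elim: n k => [//|n IH] [|[|k]] kn.
- by under eq_integral do rewrite expr0 mul1r; rewrite integral_normal_pdf.
- by rewrite rec' mul0e.
- rewrite rec' IH; last exact: ltnW.
  by rewrite -[RHS]/((k.+1 * gaussian_moment k)%:R%:E) natrM EFinM.
Qed.

End GaussianMoments.

(** * Moments of the cubature formulas *)

Section Moments.
Import numFieldNormedType.Exports.
Local Open Scope classical_set_scope.
Variable R : realType.

Lemma normal_moment k :
  (\int[normal_prob (0 : R) 1]_x (x ^+ k)%:E = (gaussian_moment k)%:R%:E)%E.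
Proof.
rewrite integral_normal_prob; last by apply/measurable_EFinP; exact: exprn_measurable.
by under eq_integral do rewrite -EFinM; exact: integral_moment.
Qed.

Lemma integrable_normal_moment k :
  (normal_prob (0 : R) 1).-integrable setT (fun x : measurableTypeR R => (x ^+ k)%:E).
Proof.
have mX : measurable_fun setT (fun x : measurableTypeR R => (x ^+ k)%:E).
  by apply/measurable_EFinP; exact: exprn_measurable.
apply/integrableP; split => //.
rewrite ge0_integral_normal_prob//; last exact: measurableT_comp.
have /integrableP[_] := integrable_moment R k.
congr (_ < _)%E; apply: eq_integral => x _.
by rewrite /= normrM (ger0_norm (normal_pdf_ge0 _ _ _)).
Qed.

Definition tuple_monomial D (k : 'I_D -> nat) (t : D.-tuple R) : R :=
  \prod_i tnth t i ^+ k i.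

Lemma measurable_tuple_monomial D (k : 'I_D -> nat) :
  measurable_fun setT (tuple_monomial k).
Proof.
apply: measurable_prod => i _; apply: measurable_funX; exact: measurable_tnth.
Qed.

(** Fubini, one coordinate at a time. Integrability is part of the induction because Fubini requires
    it; it comes from Tonelli for the absolute value, which factorizes as well. *)
Lemma std_gaussian_moment D (k : 'I_D -> nat) :
  (std_gaussian R D).-integrable setT (EFin \o tuple_monomial k) /\
  (\int[std_gaussian R D]_t (tuple_monomial k t)%:E =
    (\prod_i (gaussian_moment (k i))%:R)%:E)%E.
Proof.
have mk n (k' : 'I_n -> nat) : measurable_fun setT (EFin \o tuple_monomial k').
  by apply/measurable_EFinP; exact: measurable_tuple_monomial.
elim: D k => [|D IH] k.
  have e t : tuple_monomial k t = 1 by rewrite /tuple_monomial big_ord0.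
  split; last first.
    under eq_integral do rewrite e.
    by rewrite /= integral_cst//= diracT mule1 big_ord0.
  apply: (eq_integrable measurableT (cst 1%E)) => [t _|]; first by rewrite /= e.
  exact: finite_measure_integrable_cst.
have [iG eG] := IH (k \o lift ord0).
pose f (p : measurableTypeR R * D.-tuple R) : \bar R :=
  ((p.1 : R) ^+ k ord0 * tuple_monomial (k \o lift ord0) p.2)%:E.
have fE : (EFin \o tuple_monomial k) \o @cons_pair R D = f.
  apply/funext => -[x t]; rewrite /f /= /tuple_monomial big_ord_recl /=.
  by congr (_ * _)%:E; apply: eq_bigr => i _; rewrite tnthS.
have mf : measurable_fun setT f.
  by rewrite -fE; apply: measurableT_comp; [exact: mk|exact: measurable_cons_pair].
have iN := integrable_normal_moment (k ord0).
have if_ : (normal_prob (0 : R) 1 \x std_gaussian R D)%E.-integrable setT f.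
  apply/integrable12ltyP => //.
  have -> : (\int[normal_prob (0 : R) 1]_x \int[std_gaussian R D]_t `|f (x, t)|)%E =
     ((\int[normal_prob (0 : R) 1]_x `|(x ^+ k ord0)%:E|) *
      (\int[std_gaussian R D]_t `|(tuple_monomial (k \o lift ord0) t)%:E|))%E.
    rewrite -ge0_integralZr//; last 2 first.
    - by apply: measurableT_comp => //; exact: measurable_int iN.
    - exact: integral_ge0.
    apply: eq_integral => x _; rewrite -ge0_integralZl//.
      by apply: eq_integral => t _; rewrite /f /= normrM.
    by apply: measurableT_comp => //; exact: mk.
  apply: lte_mul_pinfty.
  - exact: integral_ge0.
  - by rewrite ge0_fin_numE ?integral_ge0//; case/integrableP : iN.
  - by case/integrableP : iG.
split.
  apply: (integrable_pushforward (@measurable_cons_pair R D) (mk _ k) _ measurableT).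
  by rewrite preimage_setT fE.
rewrite /= integral_distribution//; [|exact: mk|by rewrite fE].
have -> : (\int[(normal_prob (0 : R) 1 \x std_gaussian R D)%E]_p
    ((fun t => (tuple_monomial k t)%:E) \o @cons_pair R D) p =
    \int[(normal_prob (0 : R) 1 \x std_gaussian R D)%E]_p f p)%E by rewrite -fE.
rewrite -integral12_prod_meas1// /fubini_F /f /=.
under eq_integral do under eq_integral do rewrite EFinM.
under eq_integral do rewrite integralZl// eG.
by rewrite integralZr// normal_moment -EFinM big_ord_recl.
Qed.

Lemma integral_bernoulli_measure D (f : D.-tuple R -> R) : measurable_fun setT f ->
  (\int[bernoulli_measure R D]_t (f t)%:E =
    (2 ^- D * \sum_(b : D.-tuple bool) f (sign_point R b))%:E)%E.
Proof.
move=> mf; have mfE : measurable_fun setT (EFin \o f) by apply/measurable_EFinP.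
have ge0 (g : D.-tuple R -> \bar R) : measurable_fun setT g -> (forall t, (0 <= g t)%E) ->
    (\int[bernoulli_measure R D]_t g t =
      (2 ^- D)%:E * \sum_(b : D.-tuple bool) g (sign_point R b))%E.
  move=> mg g0; rewrite ge0_integral_mscale// ge0_integral_measure_sum//.
  congr (_ * _)%E; pose x0 := [tuple of nseq D false].
  transitivity (\sum_(b <- enum {: D.-tuple bool}) g (sign_point R b))%E; last first.
    by rewrite big_enum.
  rewrite (big_nth x0) -cardE card_tuple card_bool big_mkord; apply: eq_bigr => k _.
  by rewrite integral_dirac// diracT mul1e.
rewrite integralE !ge0//; [|exact: measurable_funeneg|exact: measurable_funepos].
have pE t : ((EFin \o f)^\+ t = (Num.max (f t) 0)%:E)%E by rewrite funeposE EFin_max.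
have nE t : ((EFin \o f)^\- t = (Num.max (- f t) 0)%:E)%E by rewrite funenegE EFin_max.
under eq_bigr do rewrite pE; under [X in (_ - _ * X)%E]eq_bigr do rewrite nE.
rewrite !sumEFin -!EFinM -EFinB -mulrBr -sumrB; congr (_ * _)%:E.
apply: eq_bigr => b _; move: (f _) => y.
by rewrite /Num.max; case: ltP => ?; case: ltP => ?; lra.
Qed.

(** Each factor on the right is the mean of [(-1) ^ (b k_i)] over one bit; distributing the product
    over these sums gives the sum over the cube. *)
Lemma bernoulli_moment D (k : 'I_D -> nat) :
  (\int[bernoulli_measure R D]_t (tuple_monomial k t)%:E =
    (\prod_i (~~ odd (k i))%:R)%:E)%E.
Proof.
rewrite integral_bernoulli_measure; last exact: measurable_tuple_monomial.
have -> : \prod_(i < D) (~~ odd (k i))%:R =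
    \prod_(i < D) (2^-1 * \sum_(b : bool) (-1) ^+ b ^+ k i) :> R.
  apply: eq_bigr => i _; rewrite big_bool /= expr0 expr1 expr1n -signr_odd.
  by case: (odd _); rewrite /= ?expr0 ?expr1; field.
rewrite big_split /= prodr_const card_ord exprVn; congr (_ * _)%:E.
rewrite bigA_distr_bigA /=.
rewrite (reindex (fun f : {ffun 'I_D -> bool} => [tuple f i | i < D])) /=; last first.
  exists (fun t : D.-tuple bool => [ffun i => tnth t i]) => [f _|t _].
    by apply/ffunP => i; rewrite ffunE tnth_mktuple.
  by apply: eq_from_tnth => i; rewrite tnth_mktuple ffunE.
by apply: eq_bigr => f _; apply: eq_bigr => i _; rewrite !tnth_mktuple.
Qed.

Lemma cubature_moment D m (mu : {measure set (D.-tuple R) -> \bar R}) n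
    (x : 'I_n -> D.-tuple R) (w : 'I_n -> R) (k : 'I_D -> nat) :
    cubature m mu x w -> (\sum_i k i <= m)%N ->
  (\int[mu]_t (tuple_monomial k t)%:E = (\sum_r w r * tuple_monomial k (x r))%:E)%E.
Proof.
move=> cub km; pose e := mpoly.Multinom [tuple k i | i < D].
have eE v : mpoly.meval v (mpoly.mpolyX R e) = \prod_i v i ^+ k i.
  by rewrite mpoly.mevalX; apply: eq_bigr => i _; rewrite mpoly.mnmE.
have := cub (mpoly.mpolyX R e); rewrite mpoly.msizeX ltnS mpoly.mdegE.
under eq_bigr do rewrite mpoly.mnmE.
move=> /(_ km); under eq_integral do rewrite eE; move=> ->; congr (_%:E).
by apply: eq_bigr => r _; rewrite eE.
Qed.

End Moments.

(** * Conclusion *)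

Lemma exponent_eval_prod (R : realType) (x : nat -> R) n e : (size e <= n)%N ->
  exponent_eval x e = \prod_(i < n) x i ^+ nth 0%N e i.
Proof.
elim: e n x => [|k e IH] n x /=.
  by move=> _; rewrite big1// => i _; rewrite nth_nil.
by case: n => // n; rewrite ltnS big_ord_recl /= => /(IH _ (fun i => x i.+1)) ->.
Qed.

Lemma sumn_ord n e : (size e <= n)%N -> sumn e = (\sum_(i < n) nth 0 e i)%N.
Proof.
elim: e n => [|k e IH] n /=; first by rewrite big1// => i _; rewrite nth_nil.
by case: n => // n; rewrite ltnS big_ord_recl /= => /IH ->.
Qed.

Lemma foldr_moment_ord n e : (size e <= n)%N ->
  foldr (fun k => muln (gaussian_moment k)) 1%N e
  = (\prod_(i < n) gaussian_moment (nth 0 e i))%N.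
Proof.
elim: e n => [|k e IH] n /=; first by rewrite big1// => i _; rewrite nth_nil.
by case: n => // n; rewrite ltnS big_ord_recl /= => /IH ->.
Qed.

Section CubatureMoments.
Variable R : realType.

Lemma gaussian_cubature_exponent n (z : 'I_n -> 3.-tuple R) (lambda : 'I_n -> R) e :
    cubature 7 (std_gaussian R 3) z lambda -> (size e <= 3)%N -> (sumn e <= 7)%N ->
  \sum_r lambda r * exponent_eval (nth 0 (z r)) e
  = (foldr (fun k => muln (gaussian_moment k)) 1%N e)%:R.
Proof.
move=> hz se de; have [_ eG] := std_gaussian_moment R (fun i : 'I_3 => nth 0%N e i).
move: eG; rewrite (cubature_moment hz) -?sumn_ord// => -[eG].
rewrite (foldr_moment_ord se) natr_prod -eG; apply: eq_bigr => r _.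
rewrite (exponent_eval_prod _ se); congr (_ * _); apply: eq_bigr => i _.
by rewrite (tnth_nth 0).
Qed.

Lemma bernoulli_cubature_moment n (eta : 'I_n -> 4.-tuple R) (mu : 'I_n -> R)
    (k : 'I_4 -> nat) :
    cubature 5 (bernoulli_measure R 4) eta mu -> (\sum_i k i <= 5)%N ->
  \sum_s mu s * tuple_monomial k (eta s) = \prod_i (~~ odd (k i))%:R.
Proof.
by move=> heta k5; have := bernoulli_moment R k; rewrite (cubature_moment heta)// => -[].
Qed.

(* [(x^2 - 1)^2] has degree 4 and mean 0, so positivity of the weights confines the
   nodes to the cube. *)
Lemma bernoulli_cubature_sqr n (eta : 'I_n -> 4.-tuple R) (mu : 'I_n -> R) s i :
    cubature 5 (bernoulli_measure R 4) eta mu -> (forall s, 0 < mu s) ->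
  tnth (eta s) i ^+ 2 = 1.
Proof.
move=> heta mu0.
have mE j (t : 4.-tuple R) : tuple_monomial (fun i' => (i' == i) * j)%N t = tnth t i ^+ j.
  rewrite /tuple_monomial (bigD1 i)//= eqxx mul1n big1 ?mulr1// => i' /negbTE ->.
  by rewrite mul0n.
have moment j : (j <= 5)%N -> ~~ odd j -> \sum_s mu s * tnth (eta s) i ^+ j = 1.
  move=> j5 oj; under eq_bigr do rewrite -mE.
  rewrite (bernoulli_cubature_moment heta).
    by apply: big1 => i' _; rewrite oddM (negbTE oj) andbF.
  rewrite (bigD1 i)//= eqxx mul1n big1 ?addn0// => i' /negbTE ->.
  by rewrite mul0n.
have sum0 : \sum_s mu s * (tnth (eta s) i ^+ 2 - 1) ^+ 2 = 0.
  transitivity (\sum_s mu s * tnth (eta s) i ^+ 4 - 2 * \sum_s mu s * tnth (eta s) i ^+ 2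
      + \sum_s mu s * tnth (eta s) i ^+ 0); last by rewrite !moment//; ring.
  rewrite big_distrr /= -sumrB -big_split; apply: eq_bigr => s' _ /=; ring.
have := psumr_eq0P (fun s' _ => mulr_ge0 (ltW (mu0 s')) (sqr_ge0 _)) sum0.
move=> /(_ s isT) /eqP; rewrite mulf_eq0 (gt_eqF (mu0 s)) /= sqrf_eq0 subr_eq0.
by move=> /eqP.
Qed.

(** The value 1 beyond the four coordinates makes [theta_i ^ 2 = 3] hold for every index, as the
    evaluation lemmas require. *)
Definition theta (eta : 4.-tuple R) (i : nat) : R :=
  Num.sqrt 3 * (if (i < 4)%N then nth 0 eta i else 1).

Lemma theta_sqr n (eta : 'I_n -> 4.-tuple R) (mu : 'I_n -> R) s i :
    cubature 5 (bernoulli_measure R 4) eta mu -> (forall s, 0 < mu s) ->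
  theta (eta s) i ^+ 2 = 3.
Proof.
move=> heta mu0; rewrite /theta exprMn sqr_sqrtr//.
case: ltnP => [i4|_]; last by rewrite expr1n mulr1.
have := bernoulli_cubature_sqr s (Ordinal i4) heta mu0; rewrite (tnth_nth 0) => ->.
by rewrite mulr1.
Qed.

(** A squarefree monomial in four variables has degree at most 4, within the exactness of the
    formula. Its mean is 0 unless it is constant. *)
Lemma bernoulli_cubature_sign n (eta : 'I_n -> 4.-tuple R) (mu : 'I_n -> R) b :
    cubature 5 (bernoulli_measure R 4) eta mu -> (size b <= 4)%N ->
  \sum_s mu s * sign_eval (theta (eta s)) b = (~~ has id b)%:R.
Proof.
move=> heta sb; pose k (i : 'I_4) := nth 0%N (map nat_of_bool b) i.
have kE i : k i = nth false b i.
  rewrite /k; case: (ltnP i (size b)) => ib; first by rewrite (nth_map false).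
  by rewrite !nth_default ?size_map.
have k5 : (\sum_i k i <= 5)%N.
  apply: (@leq_trans (\sum_(i < 4) 1)); last by rewrite sum1_card card_ord.
  by apply: leq_sum => i _; rewrite kE leq_b1.
have E s : sign_eval (theta (eta s)) b =
    (\prod_i Num.sqrt 3 ^+ k i) * tuple_monomial k (eta s).
  rewrite /sign_eval (@exponent_eval_prod _ _ 4) ?size_map// -big_split.
  by apply: eq_bigr => i _; rewrite /theta ltn_ord exprMn (tnth_nth 0).
under eq_bigr do rewrite E mulrCA.
rewrite -big_distrr /= (bernoulli_cubature_moment heta k5).
case: (boolP (has id b)) => [/(has_nthP false)[i ib bi]|nb] /=.
  have i4 : (i < 4)%N by exact: leq_trans sb.
  rewrite (bigD1 (Ordinal i4)) 1?[X in _ * X](bigD1 (Ordinal i4))//= kE bi.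
  by rewrite mul0r mulr0.
have k0 i : k i = 0%N.
  rewrite kE; case: (ltnP i (size b)) => ib; last by rewrite nth_default.
  by have /hasPn/(_ _ (mem_nth false ib)) := nb => /negbTE ->.
by rewrite !big1 ?mulr1// => i _; rewrite k0.
Qed.

End CubatureMoments.

Section Conclusion.
Variables (R : realType) (n1 n2 : nat).
Variables (z : 'I_n1 -> 3.-tuple R) (lambda : 'I_n1 -> R).
Variables (eta : 'I_n2 -> 4.-tuple R) (mu : 'I_n2 -> R).
Hypothesis hz : cubature 7 (std_gaussian R 3) z lambda.
Hypothesis heta : cubature 5 (bernoulli_measure R 4) eta mu.
Hypothesis mu_gt0 : forall s, 0 < mu s.

Let I : finType := ('I_n1 * 'I_n2)%type.
Let th (p : I) := theta (eta p.2).
Let zs (p : I) : nat -> R := nth 0 (z p.1).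
Let wt (p : I) := lambda p.1 * mu p.2.
Let lie (p : I) := wiener_lie3 (z p.1) (eta p.2).
Let X : tseries R 3 :=
  eps ord0 + 2^-1 *: \sum_(i < 3) tmul (eps (lift ord0 i)) (eps (lift ord0 i)).

Let th3 p i : th p i ^+ 2 = 3. Proof. exact: theta_sqr heta mu_gt0. Qed.

Let mean m : monomial_fits 7 m ->
  \sum_p wt p * monomial_eval (th p) (zs p) m = (monomial_mean m)%:R.
Proof.
move=> /and3P[sb se de].
transitivity ((\sum_r lambda r * exponent_eval (nth 0 (z r)) m.2) *
              (\sum_s mu s * sign_eval (theta (eta s)) m.1)).
  rewrite big_distrlr /= pair_bigA; apply: eq_bigr => p _.
  by rewrite /wt /monomial_eval [sign_eval _ _ * _]mulrC mulrACA.
rewrite (gaussian_cubature_exponent hz se de) (bernoulli_cubature_sign heta sb).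
by rewrite /monomial_mean; case: (has _ _); rewrite ?mulr0 ?mulr1.
Qed.

Let sum_wt : \sum_p wt p = 1.
Proof.
transitivity ((monomial_mean ([::], [::]))%:R : R); last by [].
rewrite -mean//.
by apply: eq_bigr => p _; rewrite /monomial_eval /sign_eval /= !mulr1.
Qed.

Let lie_agree p : agree 7 (1080 *: lie p) (trie_eval (th p) (zs p) lie3_trie).
Proof. by apply: lie3_trie_agree => // i i4; rewrite /th /theta i4. Qed.

Let X_agree p : agree 7 (1080 *: X) (trie_eval (th p) (zs p) generator_trie).
Proof. exact: generator_trie_agree. Qed.

(** Carries the grading computed on an integral trie over to the real series, through division by
    the constant. *)
Lemma agree_graded (c : R) (a : I -> tseries R 3) t : c != 0 -> trie_graded 0 t ->
  (forall p, agree 7 (c *: a p) (trie_eval (th p) (zs p) t)) ->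
  graded_series th zs 7 a.
Proof.
move=> c0 gt at_ w ordw.
apply: eq_graded (gradedZ c^-1 (trie_graded_eval th zs w gt)) => p.
rewrite -at_//; change (c^-1 * (c * a p w) = a p w).
by rewrite mulKf.
Qed.

Lemma mean_texp w : (word_order w <= 7)%N ->
  \sum_p wt p * texp (lie p) w = texp X w.
Proof.
move=> ordw; have N0 : 1080 != 0 :> R := lt0r_neq0 (ltr0Sn R 1079).
(* As the weights sum to 1, the expected signature is the mean of a constant family on the nodes, so
   the arguments for the family [lie] apply to it too. *)
have sumX : \sum_p wt p * texp X w = texp X w by rewrite -big_distrl /= sum_wt mul1r.
have [ord6|] := leqP (word_order w) 6; last first.
  move=> ord7; have {}ord7 : word_order w = 7%N by apply/eqP; rewrite eqn_leq ordw.
  have odd7 : odd (word_order w) by rewrite ord7.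
  rewrite (mean_graded_odd mean odd7 ordw (graded_texp (a := lie) th3
    (agree_graded N0 lie3_trie_graded lie_agree) ordw))//.
  by rewrite -sumX (mean_graded_odd mean odd7 ordw (graded_texp (a := fun=> X) th3
    (agree_graded N0 generator_trie_graded X_agree) ordw)).
have root0 (a : tseries R 3) p t : agree 7 (1080 *: a) (trie_eval (th p) (zs p) t) ->
    trie_root t = [::] -> a [::] = 0.
  move=> at_ t0; have := at_ [::]; rewrite [word_order _]big_nil => /(_ isT).
  have -> : trie_eval (th p) (zs p) t [::] = zpoly_eval (th p) (zs p) (trie_root t).
    by case: (t) => //=; rewrite zpoly_eval_nil.
  rewrite t0 zpoly_eval_nil => /eqP.
  by change (1080 * a [::] == 0 -> a [::] = 0); rewrite mulf_eq0 (negbTE N0) => /eqP.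
(* The common multiple produced by [exp_coefs 6] at 1080; being nonzero, it cancels at the end. *)
pose K : R := 6`!%:R * 1080 ^+ 6.
have K0 : K != 0.
  by apply: mulf_neq0; [rewrite pnatr_eq0 -lt0n fact_gt0|exact: expf_neq0].
have texpE p (a : tseries R 3) t : agree 7 (1080 *: a) (trie_eval (th p) (zs p) t) ->
    a [::] = 0 ->
  trie_eval (th p) (zs p)
      (trie_series 6 t (trie_const (Zpos xH)) (exp_coefs 6 (Z.of_nat 1080))) w
    = K * texp a w.
  move=> at_ a0; apply: (texp_trie (th3 p) (m := 6) (N := 1080)) => //.
    by move=> u ord_u; apply: at_; apply: leq_trans ord_u _.
  by move=> k k7; have := exp_coefsP R (Z.of_nat 1080) (k7 : (k <= 6)%N); rewrite zr_nat.
have lie_root : trie_root lie3_trie = [::] by vm_compute.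
have X_root : trie_root generator_trie = [::] by vm_compute.
have := mean_trie mean w difference_trie_mean.
under eq_bigr => p _.
  rewrite trie_eval_add trie_eval_scale// zpoly_eval_opp// zpoly_eval_nat mulN1r.
  rewrite (texpE p (lie p))//; last exact: root0 (lie_agree p) lie_root.
  rewrite (texpE p X)//; last exact: root0 (X_agree p) X_root.
  rewrite mulrBr mulrCA [X in _ - X]mulrCA.
  over.
rewrite sumrB -!big_distrr /= sumX -mulrBr => /eqP.
by rewrite mulf_eq0 (negbTE K0) subr_eq0 => /eqP.
Qed.

End Conclusion.

Unset Implicit Arguments.

Theorem theorem4p3 (R : realType)
    (n1 : nat) (z : 'I_n1 -> 3.-tuple R) (lambda : 'I_n1 -> R)
    (n2 : nat) (eta : 'I_n2 -> 4.-tuple R) (mu : 'I_n2 -> R)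
    (hz : cubature 7 (std_gaussian R 3) z lambda)
    (heta : cubature 5 (bernoulli_measure R 4) eta mu)
    (lambda_gt0 : forall r : 'I_n1, 0 < lambda r)
    (mu_gt0 : forall s : 'I_n2, 0 < mu s) :
  wiener_cubature 7
    (fun p : 'I_n1 * 'I_n2 => wiener_lie3 (z p.1) (eta p.2))
    (fun p : 'I_n1 * 'I_n2 => lambda p.1 * mu p.2).
Proof.
split=> [p|p|]; first exact: mulr_gt0.
  exact: wiener_lie3_truncated.
apply/funext => w.
rewrite (big_morph (fun a : tseries R 3 => a w) (id1 := 0) (op1 := +%R))//.
transitivity (\sum_(p : 'I_n1 * 'I_n2) lambda p.1 * mu p.2 *
    tproj 7 (texp (wiener_lie3 (z p.1) (eta p.2))) w); last by [].
rewrite /tproj; case: ifPn => [ordw|_].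
  by rewrite (mean_texp hz heta mu_gt0 ordw).
by rewrite big1// => p _; rewrite mulr0.
Qed.
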